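(* Let $\kappa$ be a regular uncountable cardinal and $\mu$ a cardinal. Suppose that $\vec C$ is a weakly coherent $C$-sequence over $\kappa$ such that $V(\vec C)$ contains a club in $\kappa$, and $\omega\in\Theta_1^\mu(\vec C\restriction A(\vec C),R(\vec C))$. Then $T(\rho_0^{\vec C})\nrightarrow[\kappa]^{n,1}_\mu$ holds for every positive integer $n$.
   Context: A $C$-sequence over $S\subseteq\kappa$ is $\langle C_\delta\mid\delta\in S\rangle$, each $C_\delta$ closed in $\delta$ with $\sup(C_\delta)=\sup(\delta)$. Weakly coherent: for every $\epsilon<\kappa$, $|\{C_\delta\cap\epsilon\mid\delta<\kappa\}|<\kappa$. $\mathrm{acc}(\kappa)$: nonzero limit ordinals below $\kappa$; $\mathrm{acc}(A)=\{\alpha\in A\mid\sup(A\cap\alpha)=\alpha>0\}$, $\mathrm{nacc}(A)=A\setminus\mathrm{acc}(A)$. $V(\vec C)=\{\delta\in\mathrm{acc}(\kappa)\mid\forall\alpha\in(\delta,\kappa)\,\forall\epsilon<\delta\,[C_\delta\cap[\epsilon,\delta)\ne C_\alpha\cap[\epsilon,\delta)]\}$; $A(\vec C)=\{\delta\in\mathrm{acc}(\kappa)\mid\forall\alpha\in(\delta,\kappa)\,[\delta\notin\mathrm{acc}(C_\alpha)]\}$; $R(\vec C)=\{\delta\in\mathrm{acc}(\kappa)\mid\forall\alpha\in(\delta,\kappa)\,[\mathrm{otp}(C_\alpha\cap\delta)<\delta]\}$. For $S,T\subseteq\kappa$, a $C$-sequence $\langle C_\delta\mid\delta\in S\rangle$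 and a cardinal $\mu$, $\Theta_1^\mu(\vec C,T)$ is the set of nonzero cardinals $\theta$ for which there are $g:\kappa\to\mu$, $h:\kappa\to\theta$ such that for every club $D\subseteq\kappa$ and every $\nu<\mu$ there is $\delta\in S$ with, for every $\tau<\theta$, $\sup\{\gamma\in\mathrm{nacc}(C_\delta)\cap D\cap T\mid g(\mathrm{otp}(C_\delta\cap\gamma))=\nu,\ h(\mathrm{otp}(C_\delta\cap\gamma))=\tau\}=\delta$. Here $\vec C\restriction A(\vec C)=\langle C_\delta\mid\delta\in A(\vec C)\rangle$. Walks along $\vec C=\langle C_\delta\mid\delta<\kappa\rangle$: for $\beta<\gamma$, $\mathrm{Tr}(\beta,\gamma)(0)=\gamma$, $\mathrm{Tr}(\beta,\gamma)(n)=\min(C_{\mathrm{Tr}(\beta,\gamma)(n-1)}\setminus\beta)$ if $\mathrm{Tr}(\beta,\gamma)(n-1)>\beta$, else $\beta$; $\rho_2(\beta,\gamma)$ = least $l$ with $\mathrm{Tr}(\beta,\gamma)(l)=\beta$; $\rho_0(\beta,\gamma)=\langle\mathrm{otp}(C_{\mathrm{Tr}(\beta,\gamma)(n)}\cap\beta)\mid n<\rho_2(\beta,\gamma)\rangle$. $T(\rho_0^{\vec C})=\{\rho_{0\delta}\restriction\gamma\mid\gamma\le\delta<\kappa\}$ where $\rho_{0\delta}(\xi)=\rho_0(\xi,\delta)$ for $\xi<\delta$; it is ordered by $\subseteq$ and the height of $t$ is $\mathrm{dom}(t)$. Lexicographic order: for sequences $f,g$, if comparable then $f<_{\mathrm{lex}}g$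 iff $f\supsetneq g$; otherwise at the least $i$ with $f(i)\ne g(i)$, $f<_{\mathrm{lex}}g$ iff $f(i)<g(i)$, where on ${}^{<\omega}\kappa$ entries are compared as ordinals and on $T(\rho_0^{\vec C})$ entries (elements of ${}^{<\omega}\kappa$) are compared by $<_{\mathrm{lex}}$. For nodes $x,y$, $\Delta(x,y)$ is the least common-domain point where they differ, or $\min\{\mathrm{dom}(x),\mathrm{dom}(y)\}$ if none; $x\wedge y=x\restriction\Delta(x,y)$. A set $S$ of $n$-sequences of nodes is rapid if for $\sigma\ne\sigma'$ in $S$ all heights of nodes in $\sigma$ are below all heights in $\sigma'$ or vice versa. $T\nrightarrow[\kappa]^{n,m}_\theta$: there is $c:T\to\theta$ with (1) for every rapid $S\subseteq{}^nT$ of size $\kappa$ and $\tau<\theta$ there are $(x_k)_{k<n}\ne(y_k)_{k<n}$ in $S$ with $c(x_k\wedge y_k)=\tau$ for all $k$, for all $k$ ($x_k<_{\mathrm{lex}}y_k\Rightarrow\mathrm{dom}(x_k)<\mathrm{dom}(y_k)$), and $|\{\mathrm{dom}(x_k\wedge y_k)\mid k<n\}|\le m$; (2) for every $T'\subseteq T$ of size $\kappa$ there is a rapid $S'\subseteq{}^nT'$ of size $\kappa$ such that for every $S\subseteq S'$ of size $\kappa$ and every $\tau\in{}^n\theta$ there are $(x_k)\ne(y_k)$ in $S$ with $c(x_k\wedge y_k)=\tau(k)$ for all $k$ and the last two conditions of (1). *)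

(* Defs.v *)
From Stdlib Require Import Classical ClassicalEpsilon.
From mathcomp Require Import all_boot.
Set Implicit Arguments. Unset Strict Implicit. Unset Printing Implicit Defensive.

Section Defs.
Variable K : Type.
Variable olt : K -> K -> Prop.

Definition ole (x y : K) : Prop := olt x y \/ x = y.

Definition kreg_uncountable : Prop :=
  (forall x, ~ olt x x) /\
  (forall x y z, olt x y -> olt y z -> olt x z) /\
  (forall x y, olt x y \/ x = y \/ olt y x) /\
  well_founded olt /\
  (forall a : K, ~ exists f : K -> K, injective f /\ forall x, olt (f x) a) /\
  (forall X : K -> Prop, (forall b, exists x, X x /\ ole b x) ->
      exists f : K -> K, injective f /\ forall x, X (f x)) /\
  ~ (exists f : K -> nat, injective f).

Definition below (a : K) : K -> Prop := fun x => olt x a.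
Definition inter (X Y : K -> Prop) : K -> Prop := fun x => X x /\ Y x.

Definition is_sup (X : K -> Prop) (s : K) : Prop :=
  (forall x, X x -> ole x s) /\ (forall t, (forall x, X x -> ole x t) -> ole s t).

Definition is_min (X : K -> Prop) (m : K) : Prop :=
  X m /\ forall x, X x -> ole m x.

Definition acc_of (A : K -> Prop) (a : K) : Prop :=
  A a /\ (exists x, olt x a) /\ is_sup (inter A (below a)) a.
Definition nacc_of (A : K -> Prop) (a : K) : Prop := A a /\ ~ acc_of A a.
(* acc(kappa): nonzero limit ordinals below kappa *)
Definition acc_kappa (a : K) : Prop := acc_of (fun _ => True) a.

Definition closed_in (X : K -> Prop) (d : K) : Prop :=
  (forall x, X x -> olt x d) /\
  (forall a, olt a d -> (exists x, olt x a) -> is_sup (inter X (below a)) a -> X a).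

Definition club (D : K -> Prop) : Prop :=
  (forall a, (exists x, olt x a) -> is_sup (inter D (below a)) a -> D a) /\
  (forall b, exists x, D x /\ ole b x).

(* C-sequence over kappa: C d x  means  x \in C_d *)
Definition C_sequence (C : K -> K -> Prop) : Prop :=
  forall d, closed_in (C d) d /\ exists s, is_sup (C d) s /\ is_sup (below d) s.

(* |{C_d cap e | d < kappa}| < kappa : no injection of kappa into the family *)
Definition weakly_coherent (C : K -> K -> Prop) : Prop :=
  forall e, ~ exists f : K -> (K -> Prop),
    (forall x, exists d, forall y, f x y <-> (C d y /\ olt y e)) /\
    (forall x y, (forall z, f x z <-> f y z) -> x = y).

Definition otp_is (X : K -> Prop) (a : K) : Prop :=
  exists f : K -> K,
    (forall xi, olt xi a -> X (f xi)) /\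
    (forall xi eta, olt xi a -> olt eta a -> olt xi eta -> olt (f xi) (f eta)) /\
    (forall x, X x -> exists xi, olt xi a /\ f xi = x).

Definition V_set (C : K -> K -> Prop) (d : K) : Prop :=
  acc_kappa d /\ forall a, olt d a -> forall e, olt e d ->
    ~ (forall x, ole e x -> olt x d -> (C d x <-> C a x)).

Definition A_set (C : K -> K -> Prop) (d : K) : Prop :=
  acc_kappa d /\ forall a, olt d a -> ~ acc_of (C a) d.

Definition R_set (C : K -> K -> Prop) (d : K) : Prop :=
  acc_kappa d /\ forall a, olt d a ->
    exists o, otp_is (inter (C a) (below d)) o /\ olt o d.

(* theta (a cardinal, given as a type Th) belongs to Theta_1^mu(C|S, T),
   mu given as a type M *)
Definition in_Theta1 (M Th : Type) (C : K -> K -> Prop) (S T : K -> Prop) : Prop :=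
  exists (g : K -> M) (h : K -> Th), forall D, club D -> forall nu : M,
    exists d, S d /\ forall tau : Th,
      is_sup (fun y => nacc_of (C d) y /\ D y /\ T y /\
                exists o, otp_is (inter (C d) (below y)) o /\ g o = nu /\ h o = tau) d.

Definition walk (C : K -> K -> Prop) (beta gamma : K) (t : nat -> K) (l : nat) : Prop :=
  t 0%N = gamma /\ t l = beta /\
  forall i, (i < l)%N ->
    olt beta (t i) /\ is_min (fun x => C (t i) x /\ ole beta x) (t i.+1).

Definition rho0_is (C : K -> K -> Prop) (beta gamma : K) (s : seq K) : Prop :=
  exists t l, walk C beta gamma t l /\ size s = l /\
    forall i, (i < l)%N -> otp_is (inter (C (t i)) (below beta)) (nth beta s i).

(* a node: (height gamma, f) with f xi the value at xi < gamma,
   and f xi = [::] for xi >= gamma (canonical representation) *)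
Definition node := (K * (K -> seq K))%type.

Definition in_T (C : K -> K -> Prop) (x : node) : Prop :=
  exists d, ole x.1 d /\ forall xi,
    (olt xi x.1 -> rho0_is C xi d (x.2 xi)) /\ (~ olt xi x.1 -> x.2 xi = [::]).

Definition lexl (s t : seq K) : Prop :=
  (exists u, u <> [::] /\ s = t ++ u) \/
  (exists p a b s' t', s = p ++ a :: s' /\ t = p ++ b :: t' /\ olt a b).

Definition nlex (x y : node) : Prop :=
  (olt y.1 x.1 /\ forall xi, olt xi y.1 -> x.2 xi = y.2 xi) \/
  (exists d, olt d x.1 /\ olt d y.1 /\ (forall xi, olt xi d -> x.2 xi = y.2 xi) /\
     x.2 d <> y.2 d /\ lexl (x.2 d) (y.2 d)).

Definition delta_is (x y : node) (d : K) : Prop :=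
  (olt d x.1 /\ olt d y.1 /\ (forall xi, olt xi d -> x.2 xi = y.2 xi) /\ x.2 d <> y.2 d) \/
  ((forall xi, olt xi x.1 -> olt xi y.1 -> x.2 xi = y.2 xi) /\
   ole d x.1 /\ ole d y.1 /\ (d = x.1 \/ d = y.1)).

Definition restrict (x : node) (d : K) : node :=
  (d, fun xi => if excluded_middle_informative (olt xi d) then x.2 xi else [::]).

Definition has_size_kappa (A : Type) (X : A -> Prop) : Prop :=
  exists f : K -> A, (forall a, X (f a)) /\ injective f /\
    forall z, X z -> exists a, f a = z.

Definition rapid (n : nat) (S : ('I_n -> node) -> Prop) : Prop :=
  forall s s', S s -> S s' -> s <> s' ->
    (forall k k', olt (s k).1 (s' k').1) \/ (forall k k', olt (s' k').1 (s k).1).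

(* c(x_k /\ y_k) = tau k,  x_k <lex y_k -> dom x_k < dom y_k,
   |{dom(x_k /\ y_k) | k < n}| <= m *)
Definition good_pair (Th : Type) (n m : nat) (c : node -> Th)
    (x y : 'I_n -> node) (tau : 'I_n -> Th) : Prop :=
  exists (ds : 'I_n -> K) (L : seq K), (size L <= m)%N /\ forall k,
    delta_is (x k) (y k) (ds k) /\ List.In (ds k) L /\
    c (restrict (x k) (ds k)) = tau k /\
    (nlex (x k) (y k) -> olt (x k).1 (y k).1).

Definition neg_arrow (C : K -> K -> Prop) (n m : nat) (Th : Type) : Prop :=
  exists c : node -> Th,
    (forall S : ('I_n -> node) -> Prop,
       (forall s, S s -> forall k, in_T C (s k)) -> rapid S -> has_size_kappa S ->
       forall tau : Th, exists x y, S x /\ S y /\ x <> y /\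
         good_pair m c x y (fun _ => tau)) /\
    (forall T' : node -> Prop, (forall z, T' z -> in_T C z) -> has_size_kappa T' ->
       exists S' : ('I_n -> node) -> Prop,
         (forall s, S' s -> forall k, T' (s k)) /\ rapid S' /\ has_size_kappa S' /\
         forall S : ('I_n -> node) -> Prop, (forall s, S s -> S' s) -> has_size_kappa S ->
         forall tau : 'I_n -> Th, exists x y, S x /\ S y /\ x <> y /\
           good_pair m c x y tau).

End Defs.

(* Main.v *)
(* Write σ ++ ρ0(·,γ) for the values, above some ε < γ, of a node whose walks to
   points of [ε,γ) all pass through γ. The guessing hypothesis lets us choose, at some
   δ in A(C), a large γ in nacc(C_δ) ∩ R(C) with prescribed label at o = otp(C_δ ∩ γ),
   so that a prefix σ becomes σ ++ [o]; since γ is in R(C), an elementarity argument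
   turns this into unboundedly many γ with the same prefix. Walking from these down to
   points of A(C) adds an uncontrolled block τ, so a positive set of δ carries both
   prefixes σ and σ ++ o :: τ, and iterating gives any finite number of threads. If
   two nodes have the same prefix σ at γ ≠ γ', they split at a level Δ of ρ0γ and
   ρ0γ', which does not depend on σ; Δ is not in V(C), so the value of the meet at
   max(E ∩ Δ), for a fixed club E ⊆ V(C), is a word σ ++ w whose suffix w is the same
   for all threads.

   The suffix w cannot be controlled, so the colouring must make it harmless. Each
   letter carries a class and a finite table of permutations of a set of 2n points,
   half of which are marked. Reading a word, a letter whose label exceeds all previous
   ones applies to coordinate j < ω the permutation that its table assigns to the
   previous maximum; the colour of the word is read at its first letter whose class is
   the least coordinate ending at a marked point. A record letter common to all
   threads makes their maxima equal, after which w acts on each coordinate by a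
   permutation common to all threads; preparing one thread for each possible tuple of
   permutations, one of them gets the required colours. As there are n marked and n
   unmarked points, n-tuples can be handled simultaneously, with arbitrary colours
   when their coordinates are kept apart. The lexicographic condition holds for every
   pair whose first tuple is the lower one. *)

Require Import Defs.
From Stdlib Require Import Classical ClassicalEpsilon FunctionalExtensionality PropExtensionality.
From mathcomp Require Import all_boot.
From mathcomp Require Import fingroup perm.
Set Implicit Arguments. Unset Strict Implicit. Unset Printing Implicit Defensive.

(** * Choice functions and finite sequences *)

Lemma choose_fun (A B : Type) (R : A -> B -> Prop) :
  (forall a, exists b, R a b) -> exists f, forall a, R a (f a).
Proof.
move=> H; exists (fun a => proj1_sig (constructive_indefinite_description _ (H a))) => a.
by case: constructive_indefinite_description.
Qed.

Lemma choose_fun_in (A B : Type) (b0 : B) (P : A -> Prop) (R : A -> B -> Prop) :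
  (forall a, P a -> exists b, R a b) -> exists f, forall a, P a -> R a (f a).
Proof.
move=> H; have [|f Hf] := @choose_fun A B (fun a b => P a -> R a b); last by exists f.
move=> a; case: (classic (P a)) => [/H [b Hb]|nP]; first by exists b.
by exists b0.
Qed.

Lemma cat_inj (A : Type) (s1 s2 t1 t2 : seq A) : size s1 = size s2 ->
  s1 ++ t1 = s2 ++ t2 -> s1 = s2 /\ t1 = t2.
Proof. by elim: s1 s2 => [|x s1 IH] [|y s2] //= [/IH {}IH] [-> /IH [-> ->]]. Qed.

Lemma Forall_map (A B : Type) (f : A -> B) (P : B -> Prop) (s : seq A) :
  List.Forall (fun x => P (f x)) s -> List.Forall P (map f s).
Proof. by elim=> [|x l Px _ IH] /=; constructor. Qed.

Lemma In_map (A B : Type) (f : A -> B) (s : seq A) x : List.In x s -> List.In (f x) (map f s).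
Proof. by elim: s => //= y s IH [-> | /IH]; [left | right]. Qed.

Lemma In_nth (A : Type) (x0 : A) s i : (i < size s)%N -> List.In (nth x0 s i) s.
Proof. by elim: s i => //= y s IH [|i] => [_|/IH]; [left|right]. Qed.

(** * The colouring of words *)

Section Words.
Variable n : nat.

(** The boolean is the mark of a point. *)
Definition state : finType := (bool * 'I_n)%type.
Definition label : countType := (nat * seq (nat * (seq {perm state} * {perm state})))%type.

(* Only the 2-adic valuation is decoded, so that every label has arbitrarily large codes. *)
Definition decode (m : nat) : label := odflt (0, [::]) (unpickle (logn 2 m)).

Lemma decode_ex (c : label) b : exists m, (b < m)%N /\ decode m = c.
Proof.
exists (2 ^ pickle c * b.*2.+1)%N; split.
  apply: (@leq_trans b.*2.+1); first by rewrite ltnS -addnn leq_addr.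
  by rewrite leq_pmull // expn_gt0.
rewrite /decode lognM ?expn_gt0 // pfactorK // logn_coprime ?addn0 ?pickleK //.
by rewrite coprime2n /= odd_double.
Qed.

Definition cls m : nat := (decode m).1.

(* The permutation of coordinate [j] prescribed by the letter [m] when the previous
   maximum is [M]; the last component of the entry serves all coordinates beyond the
   listed ones. *)
Definition move m M j : {perm state} :=
  let p := head ([::], 1%g) [seq q.2 | q <- (decode m).2 & q.1 == M] in nth p.2 p.1 j.

Lemma move_ex (keys : seq nat) (chi : nat -> seq {perm state} * {perm state}) i b :
  exists m, (b < m)%N /\ cls m = i /\
    forall M j, M \in keys -> move m M j = nth (chi M).2 (chi M).1 j.
Proof.
have [m [bm dm]] := decode_ex (i, [seq (M, chi M) | M <- keys]) b.
exists m; do ![split=> //]; first by rewrite /cls dm.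
move=> M j Mk; rewrite /move dm /=.
suff -> : head ([::], 1%g) [seq q.2 | q <- [seq (M0, chi M0) | M0 <- keys] & q.1 == M] = chi M by [].
by elim: keys Mk {dm} => //= a l IH; rewrite inE eq_sym; case: eqP => [->|_ /IH].
Qed.

(** [M] is the maximum of the letters read before [w]. Products of permutations act from left to
    right, so the first letter acts first. *)
Fixpoint act j M (w : seq nat) : {perm state} :=
  if w is m :: w' then ((if M < m then move m M j else 1) * act j (maxn M m) w')%g else 1%g.

Definition top (v : seq nat) := foldl maxn 0 v.

Lemma act_cat j M u w : act j M (u ++ w) = (act j M u * act j (foldl maxn M u) w)%g.
Proof. by elim: u M => [|m u IH] M /=; rewrite ?mul1g // IH mulgA. Qed.

Lemma leq_foldl_maxn M w : (M <= foldl maxn M w)%N.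
Proof. by elim: w M => //= m w IH M; apply: leq_trans (IH _); apply: leq_maxl. Qed.

Lemma top_cat v w : top (v ++ w) = foldl maxn (top v) w.
Proof. exact: foldl_cat. Qed.

Lemma top_cons_cat v m w : (m <= top (v ++ m :: w))%N.
Proof. by rewrite top_cat /=; apply: leq_trans (leq_foldl_maxn _ _); apply: leq_maxr. Qed.

(** Finitely many tables are consulted, and each entry is constant beyond its finite list of
    permutations. *)
Lemma act_const M w : exists J, forall j, (J <= j)%N -> act j M w = act J M w.
Proof.
elim: w M => [|m w IH] M; first by exists 0.
have [J HJ] := IH (maxn M m) => /=.
set p := head ([::], 1%g) [seq q.2 | q <- (decode m).2 & q.1 == M].
exists (maxn J (size p.1)) => j; rewrite geq_max => /andP [Jj sj].
rewrite (HJ j) // (HJ (maxn _ _)) ?leq_maxl //; congr mulg; case: ifP => // _.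
by rewrite /move -/p !nth_default // leq_maxr.
Qed.

Variable f0 : state.
Definition coord j v : state := act j 0 v f0.

Lemma coord_record j v m w : (top v < m)%N ->
  coord j (v ++ m :: w) = act j m w (move m (top v) j (coord j v)).
Proof. by move=> vm; rewrite /coord act_cat /= -/(top v) vm (maxn_idPr (ltnW vm)) !permM. Qed.

Definition separated v v' := top v = top v' /\ forall j, coord j v <> coord j v'.

(** Equal maxima make the common suffix act on both words by the same permutation of each
    coordinate, and permutations are injective. *)
Lemma separated_cat v v' w : separated v v' -> separated (v ++ w) (v' ++ w).
Proof.
move=> [E H]; split=> [|j]; first by rewrite !top_cat E.
rewrite /coord !act_cat -/(top v) -/(top v') E !permM => /perm_inj; exact: H.
Qed.

(** A permutation with the fewest failures has none: if [k0] fails, its image can be exchanged for a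
    point [z] with the wanted mark without spoiling any other index. *)
Lemma perm_bits (b : 'I_n -> state) (P : pred 'I_n) (u : 'I_n -> bool) :
  (forall k k', P k -> P k' -> b k = b k' -> u k = u k') ->
  exists phi : {perm state}, forall k, P k -> (phi (b k)).1 = u k.
Proof.
move=> cons; pose bad (phi : {perm state}) := [set k | P k && ((phi (b k)).1 != u k)].
case: (@arg_minnP _ (1%g : {perm state}) xpredT (fun phi => #|bad phi|)) => // phi _ min.
exists phi => k0 Pk0; apply/eqP; apply/negPn/negP => k0bad.
(* Otherwise the [n] points with mark [u k0] would use up all [n] indices as preimages, including
   [k0], whose image has the other mark. *)
have [z [zu zfree]] : exists z : state, z.1 = u k0 /\ forall k, P k -> phi (b k) = z -> u k != u k0.
  apply: NNPP => N.
  have [|f Hf] := @choose_fun 'I_n 'I_n (fun i k => P k /\ phi (b k) = (u k0, i)).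
    move=> i; apply: NNPP => N'; apply: N; exists (u k0, i); split=> // k Pk Ek.
    by case: N'; exists k.
  have fi : injective f by move=> i j Ef; have := (Hf i).2; rewrite Ef (Hf j).2 => -[].
  have [f' _ fK] := injF_bij fi; have [_] := Hf (f' k0); rewrite fK => E.
  by rewrite E eqxx in k0bad.
have := min (phi * tperm (phi (b k0)) z)%g isT; rewrite leqNgt => /negP; apply.
apply: proper_card; apply/properP; split.
  apply/subsetP => k; rewrite !inE permM => /andP [Pk]; rewrite Pk /=.
  case: tpermP => [E _|E|//]; last by move=> _; rewrite E zu eq_sym zfree.
  by rewrite E (cons k k0) // (perm_inj E).
by exists k0; rewrite !inE ?permM Pk0 ?k0bad //= tpermL zu eqxx.
Qed.

(* After the record letter [m] all words have the same maximum, so the common suffix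
   [w] acts on coordinate [j] by one permutation; the thread is chosen as the one
   prepared for the inverses of these permutations. *)
Lemma covering (cl : 'I_n -> nat) J (v : {ffun 'I_J.+1 -> {perm state}} -> 'I_n -> seq nat) b :
  (forall k, (cl k <= J)%N) ->
  (forall q k k', cl k <> cl k' -> separated (v q k) (v q k')) ->
  (forall q q' k k', q <> q' -> top (v q k) <> top (v q' k')) ->
  (forall q k, (top (v q k) <= b)%N) ->
  exists m, (b < m)%N /\ forall w, exists q, forall k,
    (coord (cl k) (v q k ++ m :: w)).1 /\
    forall j, (j < cl k)%N -> ~~ (coord j (v q k ++ m :: w)).1.
Proof.
move=> clJ sep dis vb.
(* At coordinate [j], exactly the indices of class [j] are to be marked; indices of different
   classes are separated, so no point receives two demands. *)
have [|phi Hphi] := @choose_fun ({ffun 'I_J.+1 -> {perm state}} * nat * nat) {perm state}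
  (fun qMj p => forall k, top (v qMj.1.1 k) == qMj.1.2 ->
     (p (coord qMj.2 (v qMj.1.1 k))).1 = (qMj.2 == cl k)).
  move=> [[q M] j] /=; apply: (@perm_bits _ (fun k => top (v q k) == M)) => k k' _ _ E.
  case: (cl k =P cl k') => [-> //|/(sep q) [_ /(_ j)]].
  by rewrite E.
(* Maxima differ between threads, so [M] determines [q]. The inverse of [q j] is there to be
   cancelled by a suffix acting as [q j]. *)
pose chi (M : nat) : seq {perm state} * {perm state} := if [pick q | [exists k, top (v q k) == M]] is Some q
  then (mkseq (fun j => (phi (q, M, j) * (q (inord j))^-1)%g) J.+1, 1%g) else ([::], 1%g).
have [m [bm [_ Hm]]] := move_ex
  [seq top (v qk.1 qk.2) | qk : {ffun 'I_J.+1 -> {perm state}} * 'I_n] chi 0 b.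
exists m; split=> // w; exists [ffun j : 'I_J.+1 => act j m w] => k.
set q := finfun _.
suff H j : (j <= J)%N -> (coord j (v q k ++ m :: w)).1 = (j == cl k).
  split=> [|j jk]; first by rewrite H // eqxx.
  by rewrite H ?(leq_trans (ltnW jk)) // neq_ltn jk.
move=> jJ; rewrite coord_record ?(leq_ltn_trans (vb _ _)) // Hm; last first.
  by apply/imageP; exists (q, k).
rewrite /chi; case: pickP => [q' /existsP [k' /eqP E]|/(_ q) /existsP []]; last by exists k.
have -> : q' = q by apply: NNPP => /dis; apply; exact: E.
rewrite nth_mkseq // permM ffunE inordK // permKV.
exact: (Hphi (q, top (v q k), j)).
Qed.

(** The table entry for the maximum of [v k] sends that word to [(false, k)] at every coordinate; by
    [act_const], finitely many transpositions and one default suffice. *)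
Lemma separating (v : 'I_n -> seq nat) b :
  (forall k k', k <> k' -> top (v k) <> top (v k')) -> (forall k, (top (v k) <= b)%N) ->
  exists m, (b < m)%N /\ forall k k', k <> k' -> separated (v k ++ [:: m]) (v k' ++ [:: m]).
Proof.
move=> dis vb.
have [J HJ] := choose_fun (fun k => act_const 0 (v k)).
pose t k j : {perm state} := tperm (coord j (v k)) (false, k).
pose chi (M : nat) : seq {perm state} * {perm state} := if [pick k | top (v k) == M] is Some k
  then (mkseq (t k) (J k), t k (J k)) else ([::], 1%g).
have [m [bm [_ Hm]]] := move_ex [seq top (v k) | k : 'I_n] chi 0 b.
have vm k : (top (v k) < m)%N by apply: leq_ltn_trans (vb k) bm.
have Ec k j : coord j (v k ++ [:: m]) = (false, k).
  rewrite coord_record //= perm1 Hm; last by apply/imageP; exists k.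
  rewrite /chi; case: pickP => [k' /eqP E|/(_ k)]; last by rewrite eqxx.
  have -> : k' = k by apply: NNPP => /dis; apply; exact: E.
  case: (ltnP j (J k)) => [jJ|Jj]; first by rewrite nth_mkseq // tpermL.
  by rewrite nth_default ?size_mkseq // /t /coord (HJ k j Jj) tpermL.
exists m; split=> // k k' kk; split=> [|j]; last by rewrite !Ec => -[].
by rewrite !top_cat /= !(maxn_idPr (ltnW (vm _))).
Qed.

Section Colour.
Variables (A M : Type) (g : A -> M) (h : A -> nat) (c0 : M).

Definition class_index v := epsilon (inhabits 0)
  (fun i => (coord i v).1 /\ forall j, (j < i)%N -> ~~ (coord j v).1).

Definition first_of_class (s : seq A) i := ohead [seq o <- s | cls (h o) == i].

Definition colour (s : seq A) : M := oapp g c0 (first_of_class s (class_index (map h s))).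

Lemma first_of_class_cat s t i o : first_of_class s i = Some o -> first_of_class (s ++ t) i = Some o.
Proof. by rewrite /first_of_class filter_cat; case: filter. Qed.

Lemma fresh_class (s : seq A) : exists b, forall i t, (b <= i)%N ->
  first_of_class (s ++ t) i = first_of_class t i.
Proof.
exists (\max_(o <- s) (cls (h o)).+1) => i t; rewrite /first_of_class filter_cat.
elim: s => //= o s IH; rewrite big_cons geq_max => /andP [oi /IH].
by rewrite ifN // neq_ltn oi.
Qed.

Lemma colourE s i o : (coord i (map h s)).1 -> (forall j, (j < i)%N -> ~~ (coord j (map h s)).1) ->
  first_of_class s i = Some o -> colour s = g o.
Proof.
move=> si sj so.
have [ci cj] : (coord (class_index (map h s)) (map h s)).1 /\
    forall j, (j < class_index (map h s))%N -> ~~ (coord j (map h s)).1.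
  by apply: (epsilon_spec (inhabits 0) (fun i => (coord i (map h s)).1 /\
    forall j, (j < i)%N -> ~~ (coord j (map h s)).1)); exists i.
rewrite /colour; have -> : class_index (map h s) = i; last by rewrite so.
by case: (ltngtP (class_index (map h s)) i) => // [/sj|/cj]; rewrite ?ci ?si.
Qed.

End Colour.
End Words.

(** * The well-order on [κ] *)

Section Walks.
Variables (K : Type) (olt : K -> K -> Prop).
Hypothesis HK : kreg_uncountable olt.

Local Notation "a <o b" := (olt a b) (at level 70, no associativity).
Local Notation "a <=o b" := (ole olt a b) (at level 70, no associativity).

Lemma oirr x : ~ x <o x. Proof. by case: HK => H _; apply: H. Qed.
Lemma otrans x y z : x <o y -> y <o z -> x <o z.
Proof. by case: HK => _ [H _]; apply: H. Qed.
Lemma ototal x y : x <o y \/ x = y \/ y <o x.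
Proof. by case: HK => _ [_ [H _]]; apply: H. Qed.
Lemma owf : well_founded olt.
Proof. by case: HK => _ [_ [_ [H _]]]. Qed.

Lemma olt_le_trans x y z : x <o y -> y <=o z -> x <o z.
Proof. by move=> H [H'|<-] //; apply: otrans H'. Qed.
Lemma ole_lt_trans x y z : x <=o y -> y <o z -> x <o z.
Proof. by move=> [H|->] // H'; apply: otrans H'. Qed.
Lemma ole_trans x y z : x <=o y -> y <=o z -> x <=o z.
Proof. by move=> [H|->] // H'; left; apply: olt_le_trans H'. Qed.
Lemma ole_refl x : x <=o x. Proof. by right. Qed.
Lemma oltNge x y : ~ y <=o x -> x <o y.
Proof. by move=> N; case: (ototal x y) => [//|[E|H]]; case: N; [right|left]. Qed.
Lemma oleNgt x y : ~ y <o x -> x <=o y.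
Proof. by move=> N; case: (ototal x y) => [H|[E|//]]; [left|right]. Qed.
Lemma ole_anti x y : x <=o y -> y <=o x -> x = y.
Proof. by move=> [H|//] H'; case: (oirr (olt_le_trans H H')). Qed.

Ltac osat := repeat match goal with
 | H : olt ?a ?a |- _ => exfalso; exact (oirr H)
 | H1 : olt ?a ?b, H2 : olt ?b ?c |- _ =>
     match goal with _ : olt a c |- _ => fail 1
     | _ => let h := fresh in have h := otrans H1 H2 end
 | H1 : olt ?a ?b, H2 : ole olt ?b ?c |- _ =>
     match goal with _ : olt a c |- _ => fail 1
     | _ => let h := fresh in have h := olt_le_trans H1 H2 end
 | H1 : ole olt ?a ?b, H2 : olt ?b ?c |- _ =>
     match goal with _ : olt a c |- _ => fail 1
     | _ => let h := fresh in have h := ole_lt_trans H1 H2 end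
 | H1 : ole olt ?a ?b, H2 : ole olt ?b ?c |- _ =>
     match goal with _ : ole olt a c |- _ => fail 1
     | _ => let h := fresh in have h := ole_trans H1 H2 end
 end.
(* Refutes the negated goal by saturating the context under transitivity. *)
Ltac oo := match goal with
 | |- olt _ _ => apply: oltNge => ?; osat; fail
 | |- ole olt _ _ => apply: oleNgt => ?; osat; fail
 | |- @eq K _ _ => apply: ole_anti; oo
 | |- _ => exfalso; osat; fail
 end.

Lemma oleast (P : K -> Prop) : (exists x, P x) ->
  exists x, P x /\ forall y, P y -> x <=o y.
Proof.
move=> [x]; elim/(well_founded_ind owf): x => x IH Px.
case: (classic (exists y, P y /\ y <o x)) => [[y [Py yx]]|N]; first exact: IH yx Py.
by exists x; split=> // y Py; apply: oleNgt => yx; case: N; exists y.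
Qed.

Lemma o_no_max a : exists b, a <o b.
Proof.
apply: NNPP => N; case: HK => _ [_ [_ [_ [_ [reg unc]]]]].
have [|f [fi fa]] := reg (fun x => x = a).
  by move=> b; exists a; split=> //; apply: oleNgt => ab; case: N; exists b.
by apply: unc; exists (fun=> 0) => x y _; apply: fi; rewrite !fa.
Qed.

Lemma o_inh : inhabited K.
Proof.
apply: NNPP => N; case: HK => _ [_ [_ [_ [_ [_ unc]]]]].
by apply: unc; exists (fun=> 0) => x; case: N.
Qed.

Lemma omax a b : exists c, a <=o c /\ b <=o c /\ (c = a \/ c = b).
Proof.
case: (ototal a b) => [H|[->|H]]; [exists b|exists b|exists a];
  (split; [|split]); by [left|right|auto].
Qed.

Lemma omax_lt a b c : a <o c -> b <o c -> exists d, a <=o d /\ b <=o d /\ d <o c.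
Proof.
by move=> ac bc; have [d [? [? [E|E]]]] := omax a b; exists d; split=> //; split=> //; rewrite E.
Qed.

(** * Sets of size less than [κ] *)

(** Cardinality below [κ], phrased through boundedness so that regularity applies directly. *)
Definition small (A : Type) (P : A -> Prop) :=
  forall F : A -> K, exists b, forall a, P a -> F a <o b.

(** A function unbounded on [P] has a cofinal range, into which regularity injects [κ]; preimages of
    these values then lie in [P]. *)
Lemma smallP (A : Type) (P : A -> Prop) :
  ~ (exists f : K -> A, injective f /\ forall x, P (f x)) -> small P.
Proof.
move=> Ninj F; apply: NNPP => Nb; apply: Ninj.
case: HK => _ [_ [_ [_ [_ [reg _]]]]].
have [b|f [fi fX]] := reg (fun x => exists a, P a /\ F a = x).
  apply: NNPP => N; case: Nb; exists b => a Pa; apply: oltNge => ba.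
  by apply: N; exists (F a); split=> //; exists a.
have [g Hg] := choose_fun fX; exists g; split=> [x y E|x]; last by case: (Hg x).
by apply: fi; case: (Hg x) => _ <-; case: (Hg y) => _ <-; rewrite E.
Qed.

Lemma small_below a : small (fun x => x <o a).
Proof. by apply: smallP; case: HK => _ [_ [_ [_ [H _]]]]; apply: H. Qed.

Lemma small_nat : small (fun _ : nat => True).
Proof.
by apply: smallP => -[f [fi _]]; case: HK => _ [_ [_ [_ [_ [_ []]]]]]; exists f.
Qed.

Lemma small_sub (A : Type) (P Q : A -> Prop) :
  (forall a, P a -> Q a) -> small Q -> small P.
Proof. by move=> PQ sQ F; have [b Hb] := sQ F; exists b => a /PQ; apply: Hb. Qed.

Lemma small_inj (A B : Type) (j : A -> B) (P : A -> Prop) (Q : B -> Prop) :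
  (forall a a', P a -> P a' -> j a = j a' -> a = a') ->
  (forall a, P a -> Q (j a)) -> small Q -> small P.
Proof.
move=> ji jQ sQ F; have [k0] := o_inh.
have [|G HG] := @choose_fun_in B K k0 (fun b => exists a, P a /\ j a = b)
   (fun b k => forall a, P a -> j a = b -> F a = k).
  by move=> _ [a [Pa <-]]; exists (F a) => a' Pa' E; rewrite (ji _ _ Pa' Pa E).
have [b Hb] := sQ G; exists b => a Pa.
by rewrite (HG (j a) _ a Pa erefl); [apply/Hb/jQ|exists a].
Qed.

Lemma small_image (A B : Type) (f : A -> B) (P : A -> Prop) (Q : B -> Prop) :
  (forall b, Q b -> exists a, P a /\ b = f a) -> small P -> small Q.
Proof.
move=> Qf sP F; have [b Hb] := sP (fun a => F (f a)); exists b => c /Qf [a [Pa ->]].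
exact: Hb.
Qed.

Lemma small_bigU (I A : Type) (J : I -> Prop) (P : I -> A -> Prop) :
  small J -> (forall i, J i -> small (P i)) -> small (fun a => exists i, J i /\ P i a).
Proof.
move=> sJ sP F; have [k0] := o_inh.
have [|G HG] := @choose_fun_in I K k0 J (fun i b => forall a, P i a -> F a <o b).
  by move=> i /sP; apply.
have [b Hb] := sJ G; exists b => a [i [Ji Pa]].
exact: otrans (HG _ Ji _ Pa) (Hb _ Ji).
Qed.

Lemma small_prod (A B : Type) (P : A -> Prop) (Q : B -> Prop) :
  small P -> small Q -> small (fun ab : A * B => P ab.1 /\ Q ab.2).
Proof.
move=> sP sQ; apply: (@small_sub _ _ (fun ab => exists a, P a /\ (ab.1 = a /\ Q ab.2))).
  by move=> [a b] /= [Pa Qb]; exists a.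
apply: small_bigU => // a _; apply: (small_image (f := pair a)) sQ.
by move=> [a' b] /= [-> Qb]; exists b.
Qed.

Lemma small1 (A : Type) (a : A) : small (fun x => x = a).
Proof. by move=> F; have [b Hb] := o_no_max (F a); exists b => x ->. Qed.

Lemma small_seq (A : Type) (P : A -> Prop) : small P -> small (List.Forall P).
Proof.
move=> sP; apply: (@small_sub _ _ (fun s => exists n, True /\ (size s = n /\ List.Forall P s))).
  by move=> s; exists (size s).
apply: small_bigU small_nat _ => n _; elim: n => [|n IH].
  by apply: small_sub (small1 nil) => -[|? ?] [].
apply: (small_image (f := fun p => p.1 :: p.2)) (small_prod sP IH).
by move=> [|a s] [] // [E] /List.Forall_cons_iff [Pa Ps]; exists (a, s).
Qed.

Lemma small_tuple (n : nat) (A : Type) (P : A -> Prop) :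
  small P -> small (fun f : 'I_n -> A => forall i, P (f i)).
Proof.
move=> sP; apply: (small_inj (j := fun f => [seq f i | i <- enum 'I_n])) (small_seq sP).
  move=> f g _ _ E; apply: functional_extensionality => i.
  have H := mem_enum 'I_n i; move: E H; rewrite inE; elim: (enum _) => //= j s IH [E /IH IH'].
  by rewrite inE => /orP [/eqP ->|].
by move=> f Pf; elim: (enum _) => [|i s IH] /=; constructor.
Qed.

Definition unbounded (G : K -> Prop) := forall b, exists g, b <o g /\ G g.

Lemma pigeonhole (A : Type) (Q : A -> Prop) (code : K -> A) (G : K -> Prop) :
  small Q -> unbounded G -> (forall g, G g -> Q (code g)) ->
  exists g g', g <o g' /\ G g /\ G g' /\ code g = code g'.
Proof.
move=> sQ uG GQ; apply: NNPP => N.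
suff /(_ id) [b Hb] : small G by have [g [bg /Hb gb]] := uG b; oo.
apply: small_inj GQ sQ => g g' Gg Gg' E.
by case: (ototal g g') => [H|[//|H]]; case: N; [exists g, g'|exists g', g].
Qed.

(** * Clubs *)

Definition limit a := (exists x, x <o a) /\ forall b, b <o a -> exists c, b <o c /\ c <o a.

Lemma is_sup_cofinal (X : K -> Prop) a :
  is_sup olt X a -> (forall x, X x -> x <o a) -> forall b, b <o a -> exists x, X x /\ b <o x.
Proof.
move=> [_ H] Xa b ba; apply: NNPP => N; suff: a <=o b by move=> ?; oo.
by apply: H => x Xx; apply: oleNgt => bx; apply: N; exists x.
Qed.

Lemma cofinal_is_sup (X : K -> Prop) a :
  (forall x, X x -> x <=o a) -> (forall b, b <o a -> exists x, X x /\ b <o x) ->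
  is_sup olt X a.
Proof.
move=> Xa cof; split=> // t Ht; apply: oleNgt => /cof [x [/Ht ? ?]]; oo.
Qed.

Lemma acc_kappaP a : acc_kappa olt a -> limit a.
Proof.
move=> [_ [ne sup]]; split=> // b ba.
have [|x [[_ xa] bx]] := is_sup_cofinal sup _ ba; first by move=> x [].
by exists x.
Qed.

Lemma clubP D : club olt D -> forall a, (exists x, x <o a) ->
  (forall b, b <o a -> exists x, D x /\ b <o x /\ x <o a) -> D a.
Proof.
move=> [cl _] a ne cof; apply: cl => //; apply: cofinal_is_sup => [x [_ ?]|b /cof]; first by left.
by move=> [x [Dx [bx xa]]]; exists x; split.
Qed.

Lemma club_unbounded D : club olt D -> unbounded D.
Proof.
by move=> [_ unb] b; have [c bc] := o_no_max b; have [x [Dx ?]] := unb c; exists x; split=> //; oo.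
Qed.

Lemma club_intro (D : K -> Prop) : unbounded D ->
  (forall a, (exists x, x <o a) ->
     (forall b, b <o a -> exists x, D x /\ b <o x /\ x <o a) -> D a) -> club olt D.
Proof.
move=> unb cl; split=> [a ne sup|b]; last by have [x [? ?]] := unb b; exists x; split=> //; left.
apply: cl => // b ba; have [|x [[Dx xa] bx]] := is_sup_cofinal sup _ ba; first by move=> x [].
by exists x.
Qed.

Lemma sup_seq (u : nat -> K) : (forall n, u n <o u n.+1) ->
  exists s, limit s /\ (forall n, u n <o s) /\ forall b, b <o s -> exists n, b <o u n.
Proof.
move=> inc; have [b0 Hb0] := small_nat u.
have [|s [us lub]] := @oleast (fun s => forall n, u n <o s); first by exists b0 => n; apply: Hb0.
have cof b : b <o s -> exists n, b <o u n.
  move=> bs; apply: NNPP => N; suff: s <=o b by move=> ?; oo.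
  by apply: lub => n; apply: olt_le_trans (inc n) _; apply: oleNgt => H; apply: N; exists n.+1.
exists s; split=> //; split; first by exists (u 0).
by move=> b /cof [n ?]; exists (u n).
Qed.

Lemma club_above b : club olt (fun x => b <o x).
Proof.
apply: club_intro => [c|a [x0 /[swap] /[apply] [[x [bx [_ xa]]]]]]; last by oo.
have [d [? [? _]]] := omax b c; have [e ?] := o_no_max d; exists e; split; oo.
Qed.

(** A diagonal intersection over parameters instead of ordinals: [P h] is the small set of those
    available at [h], so words can serve as indices. *)
Lemma club_diagonal (Pm : Type) (P : K -> Pm -> Prop) (DD : Pm -> K -> Prop) :
  (forall h, small (P h)) -> (forall h h' p, h <=o h' -> P h p -> P h' p) ->
  (forall p, club olt (DD p)) ->
  exists D, club olt D /\
    forall g, D g -> limit g /\ forall h p, h <o g -> P h p -> DD p g.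
Proof.
move=> sP mono cDD.
pose D g := limit g /\ forall h p, h <o g -> P h p -> DD p g.
exists D; split=> //; apply: club_intro => [b|a ne cof]; last first.
  split=> [|h p ha Php].
    by split=> // b /cof [x [_ [bx xa]]]; exists x.
  apply: (clubP (cDD p)) => // b ba; have [c [hc [bc ca]]] := omax_lt ha ba.
  have [x [[_ Dx] [cx xa]]] := cof _ ca.
  by exists x; split; [apply: Dx Php; oo|split; oo].
(* Every club with a parameter in [P h] has a point between [h] and [G h], so the supremum of the
   iterates of [G] is a limit of each club concerned. *)
have [|G HG] := @choose_fun K K (fun h e => h <o e /\
    forall p, P h p -> exists x, DD p x /\ h <o x /\ x <o e).
  move=> h.
  have [F HF] := choose_fun (fun p => club_unbounded (cDD p) h).
  have [c Hc] := sP h F; have [d hd] := o_no_max h; have [e [? [? _]]] := omax c d.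
  exists e; split=> [|p /Hc Fc]; first oo.
  by have [? ?] := HF p; exists (F p); split=> //; split=> //; oo.
pose u n := iter n G (G b).
have [|s [ls [us cof]]] := sup_seq (u := u); first by move=> n; case: (HG (u n)).
exists s; split; first by have [? _] := HG b; have /= ? := us 0; oo.
split=> // h p hs Php; apply: (clubP (cDD p)); first by exists h.
move=> c cs; have [d [hd [cd ds]]] := omax_lt hs cs; have [n dn] := cof _ ds.
have [|x [Dx [? ?]]] := (HG (u n)).2 p; first by apply: mono Php; oo.
by exists x; split=> //; split; [|have /= := us n.+1; rewrite -/(u n) => ?]; oo.
Qed.

Lemma club_inter D1 D2 : club olt D1 -> club olt D2 ->
  exists D, club olt D /\ forall g, D g -> D1 g /\ D2 g.
Proof.
move=> c1 c2.
have [h|//|[]//|D [cD HD]] := @club_diagonal bool (fun _ _ => True) (fun b => if b then D1 else D2).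
  by apply: (small_inj (j := nat_of_bool)) small_nat => // -[] [].
exists D; split=> // g /HD [[[x xg] _] H].
by split; [apply: (H x true)|apply: (H x false)].
Qed.

(** * Order types and walks *)

Definition ssup (P : K -> Prop) : K := epsilon o_inh
  (fun z => (forall y, P y -> y <o z) /\ forall z', (forall y, P y -> y <o z') -> z <=o z').

Lemma ssupP (P : K -> Prop) b : (forall y, P y -> y <o b) ->
  (forall y, P y -> y <o ssup P) /\ forall z, (forall y, P y -> y <o z) -> ssup P <=o z.
Proof.
move=> Pb; apply: (epsilon_spec o_inh (fun z => (forall y, P y -> y <o z) /\
  forall z', (forall y, P y -> y <o z') -> z <=o z')).
by apply: oleast; exists b.
Qed.

(** The order type of [X] below [x], as the strict supremum of earlier ranks: a total function,
    where [otp_is] is a relation. *)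
Definition rk (X : K -> Prop) : K -> K :=
  Fix owf (fun _ => K) (fun x rec => ssup (fun z => exists y (h : y <o x), X y /\ z = rec y h)).

Lemma rkE X x : rk X x = ssup (fun z => exists y, y <o x /\ X y /\ z = rk X y).
Proof.
rewrite /rk Fix_eq; last first.
  move=> z f g fg; congr ssup; apply: functional_extensionality => t.
  by apply: propositional_extensionality; split=> -[y [h [Xy ->]]]; exists y, h.
congr ssup; apply: functional_extensionality => t.
by apply: propositional_extensionality; split=> -[y [h [Xy ->]]]; [exists y|exists y, h].
Qed.

Lemma rk_le X x : rk X x <=o x.
Proof.
elim/(well_founded_ind owf): x => x IH; rewrite rkE.
have bx t : (exists y, y <o x /\ X y /\ t = rk X y) -> t <o x.
  by move=> [y [yx [_ ->]]]; have ? := IH y yx; oo.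
by apply: (ssupP bx).2.
Qed.

Lemma rkP X x : (forall y, X y -> y <o x -> rk X y <o rk X x) /\
  forall z, (forall y, X y -> y <o x -> rk X y <o z) -> rk X x <=o z.
Proof.
rewrite [rk X x]rkE.
have bx t : (exists y, y <o x /\ X y /\ t = rk X y) -> t <o x.
  by move=> [y [yx [_ ->]]]; have ? := rk_le X y; oo.
have [H1 H2] := ssupP bx; split=> [y Xy yx|z Hz]; first by apply: H1; exists y.
by apply: H2 => _ [y [? [? ->]]]; apply: Hz.
Qed.

Lemma rk_mono X x y : x <=o y -> rk X x <=o rk X y.
Proof. by move=> xy; apply: (rkP X x).2 => z Xz zx; apply: (rkP X y).1 => //; oo. Qed.

Lemma rk_onto X x z : z <o rk X x -> exists y, X y /\ y <o x /\ rk X y = z.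
Proof.
move=> zx; have [|y [[Xy [yx zy]] lst]] := @oleast (fun y => X y /\ y <o x /\ z <=o rk X y).
  apply: NNPP => N; suff: rk X x <=o z by move=> ?; oo.
  by apply: (rkP X x).2 => y Xy yx; apply: oltNge => ?; apply: N; exists y.
exists y; split=> //; split=> //; apply: ole_anti => //; apply: (rkP X y).2 => t Xt ty.
by apply: oltNge => H; have ? : y <=o t by [apply: lst; split=> //; split=> //; oo]; oo.
Qed.

Lemma rk_ext X Y x : (forall y, y <o x -> (X y <-> Y y)) -> rk X x = rk Y x.
Proof.
elim/(well_founded_ind owf): x => x IH XY; rewrite !rkE; congr ssup.
apply: functional_extensionality => t; apply: propositional_extensionality.
have E y : y <o x -> rk X y = rk Y y by move=> yx; apply: IH => // z zy; apply: XY; oo.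
by split=> -[y [yx [/XY H ->]]]; exists y; split=> //; split=> //; [apply: H|rewrite E|apply: H|rewrite E].
Qed.

Lemma rk_gap X e x : e <=o x -> (forall y, X y -> e <=o y -> x <=o y) -> rk X x = rk X e.
Proof.
move=> ex gap; apply: ole_anti (rk_mono _ ex); apply: (rkP X x).2 => y Xy yx.
by apply: (rkP X e).1 => //; apply: oltNge => /(gap _ Xy) ?; oo.
Qed.

Definition cofinal_below (X : K -> Prop) d := forall b, b <o d -> exists x, X x /\ b <o x /\ x <o d.

Lemma rk_cofinal X Y e d : e <o d -> cofinal_below X d ->
  (forall x, e <=o x -> x <o d -> (X x <-> Y x)) ->
  (forall x, e <=o x -> x <o d -> X x -> rk X x = rk Y x) -> rk X d <=o rk Y d.
Proof.
move=> ed cof XY rXY; apply: (rkP X d).2 => y Xy yd.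
have [c [ec [yc cd]]] := omax_lt ed yd; have [x [Xx [cx xd]]] := cof _ cd.
have ex : e <=o x by oo.
have H1 : rk X y <=o rk X x by apply: rk_mono; oo.
have H2 : rk Y x <o rk Y d by apply: (rkP Y d).1 => //; apply/XY.
by rewrite (rXY x) // in H1; oo.
Qed.

Lemma otp_rk X x : otp_is olt (inter X (below olt x)) (rk X x).
Proof.
have [f Hf] := choose_fun_in x (@rk_onto X x); exists f; split; last split.
- by move=> z /Hf [? []].
- move=> z t zx tx zt; have [_ [_ Ez]] := Hf _ zx; have [Xt [_ Et]] := Hf _ tx.
  apply: oltNge => H; have := rk_mono X H; rewrite Ez Et => ?; oo.
- move=> y [Xy yx]; have r := (rkP X x).1 y Xy yx; exists (rk X y); split=> //.
  have [Xz [zx E]] := Hf _ r; case: (ototal (f (rk X y)) y) => [H|[//|H]].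
    by have := (rkP X y).1 _ Xz H; rewrite E => ?; oo.
  by have := (rkP X _).1 _ Xy H; rewrite E => ?; oo.
Qed.

(** Comparing the enumerations gives an increasing map [u] from [b] into [a]; then [u x] is never
    below [x], which fails at [x = a]. *)
Lemma otp_not_lt X a b : otp_is olt X a -> otp_is olt X b -> ~ a <o b.
Proof.
move=> [f [fX [fi fs]]] [g [gX [gi gs]]] ab.
have [|u Hu] := @choose_fun_in K K a (fun x => x <o b) (fun x z => z <o a /\ f z = g x).
  by move=> x xb; apply: fs; apply: gX.
suff H x : x <o b -> x <=o u x by have ? := H _ ab; have [? _] := Hu _ ab; oo.
elim/(well_founded_ind owf): x => x IH xb; apply: oleNgt => ux.
have [ua E] := Hu _ xb; have ub : u x <o b by oo.
have [uua E'] := Hu _ ub; have gux := gi _ _ ub xb ux.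
have : g x <=o g (u x).
  by rewrite -E -E'; case: (IH _ ux ub) => [H|<-]; [left; apply: fi|right].
by move=> ?; oo.
Qed.

Lemma otp_rkE X x a : otp_is olt (inter X (below olt x)) a -> a = rk X x.
Proof.
move=> Ha; have Hr := otp_rk X x.
by case: (ototal a (rk X x)) => [H|[//|H]]; [case: (otp_not_lt Ha Hr)|case: (otp_not_lt Hr Ha)].
Qed.

Variable C : K -> K -> Prop.
Hypothesis HC : C_sequence olt C.

Lemma C_below d x : C d x -> x <o d.
Proof. by case: (HC d) => [[H _] _]; apply: H. Qed.

Lemma C_closed d x : x <o d -> (exists y, y <o x) -> cofinal_below (C d) x -> C d x.
Proof.
move=> xd ne cof; case: (HC d) => [[_ H] _]; apply: H => //.
apply: cofinal_is_sup => [y [_ ?]|b /cof [y [? [? ?]]]]; first by left.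
by exists y; split.
Qed.

Lemma C_acc d x : x <o d -> (exists y, y <o x) -> cofinal_below (C d) x -> acc_of olt (C d) x.
Proof.
move=> xd ne cof; split; first exact: C_closed.
split=> //; apply: cofinal_is_sup => [y [_ ?]|b /cof [y [? [? ?]]]]; first by left.
by exists y; split.
Qed.

Definition next_in d b v := is_min olt (fun x => C d x /\ b <=o x) v.

Lemma next_uniq d b v v' : next_in d b v -> next_in d b v' -> v = v'.
Proof. by move=> [vP vm] [vP' vm']; apply: ole_anti; [apply: vm|apply: vm']. Qed.

(** If [C d] had no point from [b] on, its supremum would be [b], and closedness would put the
    nonzero [b] into [C d]. *)
Lemma next_ex d b : (exists x, x <o b) -> b <o d -> exists v, next_in d b v.
Proof.
move=> [x0 x0b] bd; apply: oleast; apply: NNPP => N.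
have lt x : C d x -> x <o b by move=> Cx; apply: oltNge => ?; apply: N; exists x.
have [_ [s [sC sd]]] := HC d.
have E : s = b by apply: ole_anti; [apply: sC.2 => x /lt; left|apply: sd.1].
apply: N; exists b; split; last by right.
apply: C_closed => //; first by exists x0.
move=> c cb; rewrite -E in lt cb; have [x [Cx cx]] := is_sup_cofinal sC lt cb.
by exists x; rewrite -E; split=> //; split=> //; apply: lt.
Qed.

(* Unlike [rho0_is], total: the walk stops when there is no next step, which happens
   only at 1 on the way to 0, when [C] is empty at 1. *)
Definition rho xi : K -> seq K :=
  Fix owf (fun _ => seq K) (fun d rec =>
    if excluded_middle_informative (xi <o d /\ exists v, next_in d xi v) is left h then
      let: exist v _ := constructive_indefinite_description _ (proj2 h) in
      if excluded_middle_informative (v <o d) is left vd then rk (C d) xi :: rec v vd else [::]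
    else [::]).

Lemma rho_unfold xi d : rho xi d =
  if excluded_middle_informative (xi <o d /\ exists v, next_in d xi v) is left h then
    let: exist v _ := constructive_indefinite_description _ (proj2 h) in
    if excluded_middle_informative (v <o d) is left vd then rk (C d) xi :: rho xi v else [::]
  else [::].
Proof.
rewrite {1}/rho Fix_eq // => x f g fg; case: excluded_middle_informative => // h.
by case: constructive_indefinite_description => v _; case: excluded_middle_informative => // vd; rewrite fg.
Qed.

Lemma rho_step xi d v : xi <o d -> next_in d xi v -> rho xi d = rk (C d) xi :: rho xi v.
Proof.
move=> xd nv; rewrite rho_unfold; case: excluded_middle_informative => [h|[]]; last by split=> //; exists v.
case: constructive_indefinite_description => w nw; rewrite -(next_uniq nv nw).
case: excluded_middle_informative => // -[]; exact: C_below (nv.1.1).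
Qed.

Lemma rho_nil xi d : d <=o xi -> rho xi d = [::].
Proof. by move=> dx; rewrite rho_unfold; case: excluded_middle_informative => // h; have [? _] := h; oo. Qed.

Lemma rho_cons xi d : (exists x, x <o xi) -> xi <o d ->
  exists v, next_in d xi v /\ rho xi d = rk (C d) xi :: rho xi v.
Proof. by move=> ne xd; have [v nv] := next_ex ne xd; exists v; rewrite (rho_step xd nv). Qed.

Lemma rho_mem xi d : xi <o d -> C d xi -> rho xi d = [:: rk (C d) xi].
Proof.
move=> xd Cx; rewrite (@rho_step _ _ xi) ?rho_nil //; first by right.
by split=> [|y []]; first by split=> //; right.
Qed.

Lemma rho_size1 xi d : (exists x, x <o xi) -> xi <o d -> size (rho xi d) = 1%N -> C d xi.
Proof.
move=> ne xd; have [v [[[Cv xv] _] ->]] := rho_cons ne xd => -[].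
case: xv => [xv|->] //; by have [w [_ ->]] := rho_cons ne xv.
Qed.

Lemma rho0_rho xi d s : rho0_is olt C xi d s -> s = rho xi d.
Proof.
move=> [t [l [[t0 [tl st]] [sz o]]]].
suff H j i : (i + j = l)%N -> drop i s = rho xi (t i) by rewrite -t0 -(H l 0%N) ?drop0.
elim: j i => [|j IH] i E.
  by rewrite addn0 in E; rewrite E tl drop_oversize ?sz // rho_nil //; right.
have il : (i < l)%N by rewrite -E -addSnnS leq_addr.
have [lt nx] := st i il; rewrite (rho_step lt nx) -IH ?addSnnS // (drop_nth xi) ?sz //.
by congr cons; apply: otp_rkE; apply: o.
Qed.

Lemma walk_split d b : limit d -> d <=o b ->
  exists e s dd, e <o d /\ List.Forall (fun x => x <o d) s /\ d <=o dd /\ dd <=o b /\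
    (d <o dd -> cofinal_below (C dd) d) /\
    forall xi, e <=o xi -> xi <=o d -> rho xi b = s ++ rho xi dd.
Proof.
move=> ld; have [[x0 x0d] lim] := ld; move: b; apply: (well_founded_ind owf) => b IH [db|Ed]; last first.
  by rewrite -Ed; exists x0, [::], d; do ![split=> //]; [by right|by right|by move=> ?; oo].
case: (classic (cofinal_below (C b) d)) => [cof|N].
  by exists x0, [::], b; do ![split=> //]; [by left|by right].
have [c [cd Nc]] : exists c, c <o d /\ forall x, C b x -> c <o x -> d <=o x.
  apply: NNPP => N'; apply: N => c cd; apply: NNPP => N2; apply: N'; exists c; split=> // x Cx cx.
  by apply: oleNgt => xd; apply: N2; exists x.
have [e0 [ce0 e0d]] := lim _ cd.
have gap x : C b x -> e0 <=o x -> d <=o x by move=> Cx ?; apply: Nc => //; oo.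
have [v nv] := @next_ex b d ld.1 db; have [[Cv dv] vmin] := nv.
have vb := C_below Cv.
have [e1 [s [dd [e1d [sd [ddd [ddv [cof E]]]]]]]] := IH _ vb dv.
have [e [e0e [e1e ed]]] := omax_lt e0d e1d.
exists e, (rk (C b) d :: s), dd; do ![split=> //].
- constructor=> //; rewrite (@rk_gap _ e0) //; last by left.
  by have ? := rk_le (C b) e0; oo.
- by oo.
- move=> xi exi xid; have nx : next_in b xi v.
    split=> [|y [Cy xy]]; first by split=> //; oo.
    by apply: vmin; split=> //; apply: gap => //; oo.
  rewrite (rho_step _ nx); last by oo.
  rewrite E //=; last by oo.
  by congr cons; rewrite [RHS](@rk_gap _ xi) // => y Cy xy; apply: gap => //; oo.
Qed.

Lemma walk_split_A d b : A_set olt C d -> d <=o b ->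
  exists e s, e <o d /\ List.Forall (fun x => x <o d) s /\
    forall xi, e <=o xi -> xi <=o d -> rho xi b = s ++ rho xi d.
Proof.
move=> [/acc_kappaP ld Ad] db.
have [e [s [dd [ed [sd [[ddd|Ed] [ddb [cof E]]]]]]]] := walk_split ld db.
  by case: (Ad _ ddd); apply: C_acc => //; [exact: ld.1|exact: cof].
by rewrite -Ed in E; exists e, s.
Qed.

Lemma C_cofinal d : limit d -> cofinal_below (C d) d.
Proof.
move=> [ne lim] b bd; have [_ [s [sC sd]]] := HC d.
have E : s = d.
  apply: ole_anti; first by apply: sd.2 => x; left.
  by apply: oleNgt => /lim [c [sc cd]]; have ? := sd.1 _ cd; oo.
rewrite E in sC; have [|x [Cx bx]] := is_sup_cofinal sC _ bd; first by move=> x /C_below.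
by exists x; split=> //; split=> //; apply: C_below.
Qed.

(** At a point of [C da] the walk from [a] makes one step after [sa], while the walk from [b] makes
    at least one after [sb]. *)
Lemma walk_prefix_size e d a b sa sb da db : e <o d -> (exists x, x <o e) ->
  cofinal_below (C da) d -> d <=o da -> d <=o db ->
  (forall xi, e <=o xi -> xi <o d -> rho xi a = rho xi b) ->
  (forall xi, e <=o xi -> xi <=o d -> rho xi a = sa ++ rho xi da) ->
  (forall xi, e <=o xi -> xi <=o d -> rho xi b = sb ++ rho xi db) ->
  (size sb <= size sa)%N.
Proof.
move=> ed [x0 x0e] cof dda ddb E Ea Eb; have [x [Cx [ex xd]]] := cof _ ed.
have xda : x <o da by oo.
have xdb : x <o db by oo.
have := E x (or_introl ex) xd; rewrite Ea ?Eb; try by left.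
rewrite (rho_mem xda Cx) => /(congr1 size); rewrite !size_cat addn1.
have [|v [_ ->]] := rho_cons _ xdb; first by exists x0; oo.
by rewrite /= addnS => -[->]; apply: leq_addr.
Qed.

(* At [d] in [V], whether a walk passes through [d] or only accumulates to it can be
   read off below [d], so the tree does not branch there. *)
Lemma V_no_split d a b : V_set olt C d -> d <=o a -> d <=o b ->
  (forall xi, xi <o d -> rho xi a = rho xi b) -> rho d a = rho d b.
Proof.
move=> [/acc_kappaP ld Vd] da db E.
have [ea [sa [da' [ead [_ [dda [_ [cofa Ea]]]]]]]] := walk_split ld da.
have [eb [sb [db' [ebd [_ [ddb [_ [cofb Eb]]]]]]]] := walk_split ld db.
have [e0 [eae [ebe e0d]]] := omax_lt ead ebd; have [e [e0e ed]] := ld.2 _ e0d.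
have ne : exists x, x <o e by exists e0.
have {}cofa : cofinal_below (C da') d.
  by case: dda => [/cofa //|<-]; apply: C_cofinal.
have {}cofb : cofinal_below (C db') d.
  by case: ddb => [/cofb //|<-]; apply: C_cofinal.
have {eae}Ea xi : e <=o xi -> xi <=o d -> rho xi a = sa ++ rho xi da'.
  by move=> *; apply: Ea => //; oo.
have {ebe}Eb xi : e <=o xi -> xi <=o d -> rho xi b = sb ++ rho xi db'.
  by move=> *; apply: Eb => //; oo.
have Es : size sa = size sb.
  apply/eqP; rewrite eqn_leq; apply/andP; split.
    by apply: (@walk_prefix_size e d b a sb sa db' da') => // xi _ xd; rewrite E.
  by apply: (@walk_prefix_size e d a b sa sb da' db') => // xi _ xd; rewrite E.
have Er xi : e <=o xi -> xi <o d -> sa = sb /\ rho xi da' = rho xi db'.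
  move=> exi xid; have := E _ xid; rewrite Ea ?Eb //; try by left.
  exact: cat_inj.
have sab : sa = sb by have [] := Er e (ole_refl e) ed.
(* Membership in these sets shows as a walk of length one. *)
have Cab x : e <=o x -> x <o d -> (C da' x <-> C db' x).
  move=> ex xd; have [_ Ex] := Er _ ex xd.
  have xa : x <o da' by oo.
  have xb : x <o db' by oo.
  have nx : exists y, y <o x by exists e0; oo.
  split=> Cx; apply: rho_size1 => //; first by rewrite -Ex rho_mem.
  by rewrite Ex rho_mem.
rewrite Ea; [|by left|by right]; rewrite Eb; [|by left|by right]; rewrite sab; congr cat.
(* If both [da'] and [db'] exceed [d], the ranks agree on a tail and so at [d]; if just one does,
   its set agrees with [C d] near [d], against [V]. *)
case: dda => [dda|Ed]; case: ddb => [ddb|Ed'].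
- have Ca := C_closed dda ld.1 cofa; have Cb := C_closed ddb ld.1 cofb.
  rewrite !rho_mem //; congr [:: _].
  have Erk x : e <=o x -> x <o d -> rk (C da') x = rk (C db') x.
    move=> ex xd; have [_] := Er _ ex xd.
    have nx : exists y, y <o x by exists e0; oo.
    have [|v [_ ->]] := @rho_cons x da' nx; first by oo.
    by have [|w [_ ->]] := @rho_cons x db' nx; [oo|case].
  apply: ole_anti; apply: (@rk_cofinal _ _ e) => //.
  + by move=> x ex xd _; apply: Erk.
  + by move=> x ex xd; split=> ?; apply/Cab.
  + by move=> x ex xd _; rewrite Erk.
- by case: (Vd _ dda e ed) => x ex xd; rewrite Ed' Cab.
- by case: (Vd _ ddb e ed) => x ex xd; rewrite {1}Ed Cab.
- by rewrite -Ed -Ed'.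
Qed.

(** At [g] one value is empty and the other is not, so by [V_no_split] a difference occurs below
    [g]; the same lemma keeps the least one out of [V]. *)
Lemma rho_split g g' : V_set olt C g -> g <o g' ->
  exists d, d <o g /\ rho d g <> rho d g' /\ (forall xi, xi <o d -> rho xi g = rho xi g') /\
    ~ V_set olt C d.
Proof.
move=> Vg gg'.
have [|d [[dg nd] dmin]] := @oleast (fun d => d <o g /\ rho d g <> rho d g').
  apply: NNPP => N; have [v [_ ]] := rho_cons (acc_kappaP Vg.1).1 gg'.
  suff -> : rho g g' = [::] by [].
  rewrite -(@rho_nil g g); last by right.
  symmetry; apply: V_no_split => //; [by right|by left|].
  by move=> xi xg; apply: NNPP => ne; apply: N; exists xi.
have E xi : xi <o d -> rho xi g = rho xi g'.
  by move=> xd; apply: NNPP => ne; have ? : d <=o xi by [apply: dmin; split=> //; oo]; oo.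
exists d; split=> //; split=> //; split=> // Vd; apply: nd; apply: V_no_split => //; first by left.
by left; oo.
Qed.

(** * Levels of the tree *)

Definition cut (A : Type) (h : K) (f : K -> seq A) : K -> seq A :=
  fun xi => if excluded_middle_informative (xi <o h) then f xi else [::].

Lemma cut_in A h (f : K -> seq A) xi : xi <o h -> cut h f xi = f xi.
Proof. by rewrite /cut; case: excluded_middle_informative. Qed.

Lemma eq_cut A h (f g : K -> seq A) : (forall xi, xi <o h -> f xi = g xi) -> cut h f = cut h g.
Proof.
move=> fg; apply: functional_extensionality => xi; rewrite /cut.
by case: excluded_middle_informative => // ?; apply: fg.
Qed.

Hypothesis Hwc : weakly_coherent olt C.

Definition level h (f : K -> seq K) := exists d, f = cut h (fun xi => rho xi d).

Lemma small_traces h : small (fun X : K -> Prop => exists d, X = (fun y => C d y /\ y <o h)).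
Proof.
apply: smallP => -[f [fi fX]]; apply: (Hwc (e := h)); exists f; split=> [x|x y E].
  by have [d ->] := fX x; exists d => y.
by apply: fi; apply: functional_extensionality => z; apply: propositional_extensionality.
Qed.

(** A node of height [h] is determined by finitely many traces of [C] sets on [h], which are few by
    weak coherence, and the ordinal at most [h] where the walk towards [h] ends. [W n] collects the
    nodes using [n] traces. *)
Lemma small_level h : small (level h).
Proof.
have [k0] := o_inh.
pose nxt (Y : K -> Prop) xi := is_min olt (fun x => Y x /\ xi <=o x).
(* [G] recovers [rho] below [h] from the trace of [C d] on [h] and the node of the
   first step above [h]. *)
pose G (p : (K -> Prop) * (K -> seq K)) := cut h (fun xi =>
  rk p.1 xi :: if excluded_middle_informative (exists u, nxt p.1 xi u) is left H
    then rho xi (proj1_sig (constructive_indefinite_description _ H)) else p.2 xi).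
pose W := fix W n : (K -> seq K) -> Prop := if n is n'.+1
  then fun f => exists p, ((exists d, p.1 = (fun y => C d y /\ y <o h)) /\ W n' p.2) /\ f = G p
  else fun f => exists d, d <=o h /\ f = cut h (fun xi => rho xi d).
have sW n : small (W n).
  elim: n => [|n IH]; last first.
    by apply: (small_image (f := G) _ (small_prod (small_traces h) IH)) => f [p [? ?]]; exists p.
  apply: (small_image (f := fun d => cut h (fun xi => rho xi d)) (P := fun d => d <=o h)).
    by move=> f [d [? ->]]; exists d.
  by have [c hc] := o_no_max h; apply: small_sub (small_below c) => d ?; oo.
apply: small_sub (small_bigU small_nat (fun n _ => sW n)) => _ [d ->].
elim/(well_founded_ind owf): d => d IH; case: (classic (d <=o h)) => [dh|Ndh].
  by exists 0; split=> //; exists d.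
have hd : h <o d by apply: oltNge.
case: (classic (exists x, x <o h)) => [ne|N]; last first.
  exists 0; split=> //; exists h; split; first by right.
  by apply: eq_cut => xi xh; case: N; exists xi.
have [v [nv Ev]] := rho_cons ne hd; have [[Cv hv] vmin] := nv.
have [n [_ Wn]] := IH _ (C_below Cv); exists n.+1; split=> //.
exists ((fun y => C d y /\ y <o h), cut h (fun xi => rho xi v)); split.
  by split=> //; exists d.
apply: eq_cut => xi xh /=.
have Erk : rk (C d) xi = rk (fun y => C d y /\ y <o h) xi.
  by apply: rk_ext => y yx; split=> [?|[]] //; split=> //; oo.
case: excluded_middle_informative => [H|N].
  case: constructive_indefinite_description => u [[[Cu uh] xu] umin] /=.
  rewrite (@rho_step _ _ u) ?Erk //; first by oo.
  split=> // y [Cy xy]; case: (classic (y <o h)) => [yh|/oleNgt hy]; last by oo.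
  by apply: umin.
rewrite cut_in // (@rho_step _ _ v) ?Erk //; first by oo.
split=> [|y [Cy xy]]; first by split=> //; oo.
apply: vmin; split=> //; apply: oleNgt => yh; apply: N.
by apply: oleast; exists y.
Qed.

(** * Guessing clubs *)

Variable E : K -> Prop.
Hypothesis cE : club olt E.
Hypothesis EV : forall d, E d -> V_set olt C d.
Variables (M : Type) (g : K -> M) (h : K -> nat).

Definition guesses nu (D : K -> Prop) d := forall tau : nat,
  is_sup olt (fun y => nacc_of olt (C d) y /\ D y /\ R_set olt C y /\
    exists o, otp_is olt (inter (C d) (below olt y)) o /\ g o = nu /\ h o = tau) d.

(** The analogue of stationarity for guessing at points of [A(C)]. *)
Definition positive nu (X : K -> Prop) := forall D, club olt D ->
  exists d, X d /\ A_set olt C d /\ guesses nu D d.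

Lemma guesses_point nu D d tau b : guesses nu D d -> b <o d ->
  exists y, nacc_of olt (C d) y /\ D y /\ R_set olt C y /\ b <o y /\ y <o d /\
    g (rk (C d) y) = nu /\ h (rk (C d) y) = tau.
Proof.
move=> gD bd; have [|y [[[Cy Ny] [Dy [Ry [o [/otp_rkE -> [go ho]]]]]] by_]] := is_sup_cofinal (gD tau) _ bd.
  by move=> x [[/C_below]].
by exists y; do ![split=> //]; apply: C_below.
Qed.

Lemma guesses_tail nu D D' d b : guesses nu D d -> b <o d ->
  (forall y, D y -> b <o y -> D' y) -> guesses nu D' d.
Proof.
move=> gD bd DD' tau; apply: cofinal_is_sup => [x [[/C_below]]|c cd]; first by left.
have [e [be [ce ed]]] := omax_lt bd cd.
have [y [Ny [Dy [Ry [ey [yd [gy hy]]]]]]] := guesses_point tau gD ed.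
exists y; split; last by oo.
split=> //; split; first by apply: DD' => //; oo.
by split=> //; exists (rk (C d) y); split=> //; apply: otp_rk.
Qed.

Lemma positive_above nu b X : positive nu X -> positive nu (fun d => X d /\ b <o d).
Proof.
move=> pX D cD; have [D' [cD' HD']] := club_inter cD (club_above b).
have [d [Xd [Ad gd]]] := pX _ cD'.
have [[x xd] _] := acc_kappaP Ad.1.
have [y [_ [/HD' [_ by_] [_ [_ [yd _]]]]]] := guesses_point 0 gd xd.
exists d; split; first by split=> //; oo.
by split=> //; apply: guesses_tail gd xd _ => z /HD' [].
Qed.

Lemma positive_press (Pm : Type) (P : K -> Pm -> Prop) (Rel : K -> Pm -> Prop) nu X :
  (forall b, small (P b)) -> (forall b b' p, b <=o b' -> P b p -> P b' p) ->
  positive nu X ->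
  (forall d, X d -> A_set olt C d -> exists p b, b <o d /\ P b p /\ Rel d p) ->
  exists p, positive nu (fun d => X d /\ Rel d p).
Proof.
move=> sP mono pX H; apply: NNPP => N.
have [|DD HDD] := @choose_fun Pm (K -> Prop) (fun p D => club olt D /\
    forall d, X d -> Rel d p -> A_set olt C d -> ~ guesses nu D d).
  move=> p; apply: NNPP => N'; apply: N; exists p => D cD; apply: NNPP => N2; apply: N'.
  by exists D; split=> // d Xd Rd Ad gd; apply: N2; exists d.
have [D [cD HD]] := club_diagonal sP mono (fun p => (HDD p).1).
have [d [Xd [Ad gd]]] := pX D cD; have [p [b [bd [Pp Rp]]]] := H _ Xd Ad.
apply: ((HDD p).2 d) => //; apply: guesses_tail gd bd _ => y /HD [_ Hy] by_.
exact: Hy Pp.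
Qed.

(** * Nodes passing through an ordinal *)

Definition pass (x : node K) e d (s : seq K) :=
  d <=o x.1 /\ forall xi, e <=o xi -> xi <o d -> x.2 xi = s ++ rho xi d.

Lemma pass_le x e e' d s : e <=o e' -> pass x e d s -> pass x e' d s.
Proof. by move=> ee [dx H]; split=> // xi ? ?; apply: H => //; oo. Qed.

Section Tuples.
Variable n : nat.
Implicit Types (S : ('I_n -> node K) -> Prop) (s : 'I_n -> seq K) (fam : seq ('I_n -> seq K)).

Definition acc_at S e d s := exists x, S x /\ forall k, pass (x k) e d (s k).
Definition ext s (t : seq K) : 'I_n -> seq K := fun k => s k ++ t.
Definition wle b s := forall k, List.Forall (fun x => x <=o b) (s k).
(** The bound [c] below [d] on the threshold and the words is what allows pressing down. *)
Definition accessible S (Q : ('I_n -> seq K) -> Prop) := exists b, forall d, A_set olt C d -> b <o d ->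
  exists e c s, e <=o c /\ c <o d /\ wle c s /\ acc_at S e d s /\ Q s.
Definition unbounded_family S fam :=
  exists e, unbounded (fun d => E d /\ List.Forall (acc_at S e d) fam).

Lemma acc_at_le S e e' d s : e <=o e' -> acc_at S e d s -> acc_at S e' d s.
Proof. by move=> ee [x [Sx Hx]]; exists x; split=> // k; apply: pass_le ee (Hx k). Qed.

Lemma fin_max m (Q : 'I_m -> K -> Prop) d : (exists x, x <o d) ->
  (forall k b c, b <=o c -> Q k b -> Q k c) ->
  (forall k, exists b, b <o d /\ Q k b) -> exists b, b <o d /\ forall k, Q k b.
Proof.
move=> [x xd] mono HQ.
have [b [bd Hb]] : exists b, b <o d /\ forall k, k \in enum 'I_m -> Q k b.
  elim: (enum _) => [|k l [b [bd Hb]]]; first by exists x.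
  have [c [cd Qc]] := HQ k; have [a [ba [ca ad]]] := omax_lt bd cd.
  exists a; split=> // j; rewrite inE => /orP [/eqP ->|/Hb Qj]; [exact: mono Qc|exact: mono Qj].
by exists b; split=> // k; apply: Hb; rewrite mem_enum.
Qed.

Lemma Forall_le_mono b c (l : seq K) : b <=o c ->
  List.Forall (fun x => x <=o b) l -> List.Forall (fun x => x <=o c) l.
Proof. by move=> bc; apply: List.Forall_impl => x ?; oo. Qed.

Lemma Forall_max d (l : seq K) : (exists x, x <o d) ->
  List.Forall (fun x => x <o d) l -> exists b, b <o d /\ List.Forall (fun x => x <=o b) l.
Proof.
move=> [x xd]; elim: l => [|y l IH]; first by exists x.
move=> /List.Forall_cons_iff [yd /IH [b [bd Hb]]]; have [c [yc [bc cd]]] := omax_lt yd bd.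
by exists c; split=> //; constructor=> //; apply: Forall_le_mono Hb.
Qed.

Lemma Forall_max_any (l : seq K) : exists b, List.Forall (fun x => x <=o b) l.
Proof.
have [k0] := o_inh; elim: l => [|y l [b Hb]]; first by exists k0.
have [c [yc [bc _]]] := omax y b; exists c; constructor=> //; exact: Forall_le_mono Hb.
Qed.

Lemma wle_mono b c s : b <=o c -> wle b s -> wle c s.
Proof. by move=> bc H k; apply: Forall_le_mono (H k). Qed.

Lemma wle_any s : exists b, wle b s.
Proof.
have [f Hf] := choose_fun (fun k => Forall_max_any (s k)).
have [b Hb] := Forall_max_any [seq f k | k <- enum 'I_n].
exists b => k; apply: Forall_le_mono (Hf k).
have := mem_enum 'I_n k; rewrite inE; elim: (enum _) Hb => //= j l IH /List.Forall_cons_iff [fb /IH H].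
by rewrite inE => /orP [/eqP ->|].
Qed.

Lemma wle_any_fam fam : exists b, List.Forall (wle b) fam.
Proof.
have [k0] := o_inh; elim: fam => [|s l [b Hb]]; first by exists k0.
have [a Ha] := wle_any s; have [c [ac [bc _]]] := omax a b; exists c.
constructor; first exact: wle_mono Ha.
by apply: List.Forall_impl Hb => t; apply: wle_mono.
Qed.

Lemma small_le b : small (fun x => x <=o b).
Proof. by have [c bc] := o_no_max b; apply: small_sub (small_below c) => d ?; oo. Qed.

Lemma small_wle b : small (wle b).
Proof. exact: small_tuple (small_seq (small_le b)). Qed.

Lemma accessible_sub S (Q Q' : ('I_n -> seq K) -> Prop) :
  (forall s, Q s -> Q' s) -> accessible S Q -> accessible S Q'.
Proof.
move=> QQ [b Hb]; exists b => d Ad bd; have [e [c [s [? [? [? [? /QQ ?]]]]]]] := Hb d Ad bd.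
by exists e, c, s.
Qed.

(** The walk from a far [y] towards a point [d] of [A(C)] passes through [d]; its block [t] of
    values below [d] is appended to all components alike. *)
Lemma unbounded_accessible S s : unbounded_family S [:: s] ->
  accessible S (fun s' => exists t, s' = ext s t).
Proof.
move=> [e ue]; have [b0 Hb0] := wle_any s; have [b [eb [b0b _]]] := omax e b0.
exists b => d Ad bd; have [y [dy [Ey /List.Forall_cons_iff [[x [Sx Hx]] _]]]] := ue d.
have [e1 [t [e1d [td Et]]]] := walk_split_A Ad (or_introl dy).
have [b1 [b1d Hb1]] := Forall_max (acc_kappaP Ad.1).1 td.
have [c0 [bc0 [e1c0 c0d]]] := omax_lt bd e1d; have [c [c0c [b1c cd]]] := omax_lt c0d b1d.
exists c, c, (ext s t); split; first exact: ole_refl.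
split=> //; split.
  move=> k; apply/List.Forall_app; split; last exact: Forall_le_mono Hb1.
  by apply: Forall_le_mono (Hb0 k); oo.
split; last by exists t.
exists x; split=> // k; have [yx Hk] := Hx k; split=> [|xi cxi xid]; first by oo.
rewrite Hk; [|by oo|by oo]; rewrite Et; [|by oo|by oo]; by rewrite /ext catA.
Qed.

Lemma accessible_press S Q nu X : positive nu X -> accessible S Q ->
  exists e s, Q s /\ positive nu (fun d => X d /\ acc_at S e d s).
Proof.
move=> pX [b0 Hb0].
pose P b (p : K * ('I_n -> seq K)) := p.1 <=o b /\ wle b p.2.
have [||d [Xd b0d] Ad|[e s] /= pos] := @positive_press _ P (fun d p => acc_at S p.1 d p.2 /\ Q p.2)
    nu _ _ _ (positive_above b0 pX).
- by move=> b; apply: small_prod (small_le b) (small_wle b).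
- by move=> b b' p bb [p1 p2]; split; [oo|apply: wle_mono p2].
- by have [e [c [s [ec [cd [ws [As Qs]]]]]]] := Hb0 d Ad b0d; exists (e, s), c.
exists e, s; split; last by move=> D /pos [d [[[Xd _] [As _]] [Ad gd]]]; exists d.
by have [d [[_ []]]] := pos _ cE.
Qed.

(* The values of [rho] at [y] lie below [y] because [y] is in [R], so a bounded family
   of witnesses would have been left behind by the diagonal club. *)
Lemma jump S nu e fam m : positive nu (fun d => List.Forall (acc_at S e d) fam) ->
  exists o, g o = nu /\ h o = m /\ unbounded_family S [seq ext s [:: o] | s <- fam].
Proof.
move=> pos; have [b0 Hb0] := wle_any_fam fam; have [b [eb [b0b _]]] := omax e b0.
pose P c (p : K * seq ('I_n -> seq K)) := p.1 <=o c /\ List.Forall (wle c) p.2.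
pose G (p : K * seq ('I_n -> seq K)) y := E y /\ List.Forall (acc_at S p.1 y) p.2.
have [|F HF] := @choose_fun _ K (fun p c => unbounded (G p) \/ forall y, G p y -> y <=o c).
  move=> p; apply: NNPP => N; apply: (N); have [k0] := o_inh; exists k0; left=> c.
  apply: NNPP => N2; apply: N; exists c; right=> y Gy; apply: oleNgt => cy; apply: N2.
  by exists y.
have [c|c c' p cc [p1 p2]|p|D1 [cD1 HD1]] :=
    @club_diagonal _ P (fun p y => F p <o y).
- exact: small_prod (small_le c) (small_seq (small_wle c)).
- by split; [oo|apply: List.Forall_impl p2 => s; apply: wle_mono].
- exact: club_above.
have [D [cD HD]] := club_inter cD1 cE.
have [d [[Hd bd] [Ad gd]]] := positive_above b pos cD.
have [y [[Cy Ny] [/HD [D1y Ey] [Ry [by_ [yd [gy hy]]]]]]] := guesses_point m gd bd.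
have ly := acc_kappaP Ry.1.
set o := rk (C d) y in gy hy.
have oy' : o <o y by have [o' [/otp_rkE -> ?]] := Ry.2 d yd.
(* As [y] is a limit outside [acc(C d)], the part of [C d] below [y] is bounded, so walks from [d]
   to points just under [y] step first to [y]. *)
have [c [cy Nc]] : exists c, c <o y /\ forall x, C d x -> c <o x -> y <=o x.
  apply: NNPP => N; apply: Ny; apply: C_acc => //; first exact: ly.1.
  move=> c cy; apply: NNPP => N2; apply: N; exists c; split=> // x Cx cx.
  by apply: oleNgt => xy; apply: N2; exists x.
have [c0 [bc0 [cc0 c0y]]] := omax_lt by_ cy; have [e' [c0e' e'y]] := ly.2 _ c0y.
have step xi : e' <=o xi -> xi <o y -> rho xi d = o :: rho xi y.
  move=> exi xiy; have gap x : C d x -> xi <=o x -> y <=o x.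
    by move=> Cx ?; apply: Nc => //; oo.
  rewrite (@rho_step _ _ y); [|by oo|].
    by congr cons; rewrite /o [RHS](@rk_gap _ xi) //; left.
  by split=> [|x [Cx xix]]; [split=> //; left|apply: gap].
exists o; split=> //; split=> //; exists e'.
have [a [e'a [oa ay]]] := omax_lt e'y oy'; have [a' [aa' [ba' a'y]]] := omax_lt ay by_.
case: (HF (e', [seq ext s [:: o] | s <- fam])) => [//|H]; exfalso.
have Gy : G (e', [seq ext s [:: o] | s <- fam]) y.
  split=> //=; apply: Forall_map; apply: List.Forall_impl Hd => s [x [Sx Hx]].
  exists x; split=> // k; have [dx Hk] := Hx k; split=> [|xi exi xiy]; first by oo.
  rewrite Hk; [|by oo|by oo]; by rewrite step // /ext -catA.
have yF := H _ Gy; suff ? : F (e', [seq ext s [:: o] | s <- fam]) <o y by oo.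
apply: (HD1 _ D1y).2 a'y _; split=> /=; first by oo.
apply: Forall_map; apply: List.Forall_impl Hb0 => s ws k.
apply/List.Forall_app; split; first by apply: Forall_le_mono (ws k); oo.
by constructor=> //; oo.
Qed.

(** Only the extended thread leaves by the jump and walks back down; pressing takes place on the
    given positive set, where the old threads persist. *)
Lemma add_thread S nu e s fam m : positive nu (fun d => List.Forall (acc_at S e d) (s :: fam)) ->
  exists o t e', g o = nu /\ h o = m /\
    positive nu (fun d => List.Forall (acc_at S e' d) (ext s (o :: t) :: s :: fam)).
Proof.
move=> pos; have [o [go [ho [e1 u1]]]] := jump m pos.
have us : unbounded_family S [:: ext s [:: o]].
  exists e1 => b; have [d [bd [Ed /List.Forall_cons_iff [Hs _]]]] := u1 b.
  by exists d; do ![split=> //]; constructor.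
have [e2 [_ [[t ->] pos2]]] := accessible_press pos (unbounded_accessible us).
have [e' [ee' [e2e' _]]] := omax e e2; exists o, t, e'; do ![split=> //].
move=> D /pos2 [d [[Hd As] [Ad gd]]]; exists d; split=> //; constructor.
  have -> : ext s (o :: t) = ext (ext s [:: o]) t.
    by apply: functional_extensionality => k; rewrite /ext -catA.
  exact: acc_at_le As.
by apply: List.Forall_impl Hd => r; apply: acc_at_le.
Qed.

End Tuples.

(** * Splitting levels and the last point of [E] below them *)

Definition last_E d := epsilon o_inh (fun e => E e /\ e <o d /\ forall y, E y -> y <o d -> y <=o e).

Lemma last_EP d : ~ E d -> (exists y, E y /\ y <o d) ->
  E (last_E d) /\ last_E d <o d /\ forall y, E y -> y <o d -> y <=o last_E d.
Proof.
move=> Nd [y0 [Ey0 y0d]].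
apply: (epsilon_spec o_inh (fun e => E e /\ e <o d /\ forall y, E y -> y <o d -> y <=o e)).
have [|s [sE slub]] := @oleast (fun s => forall y, E y -> y <o d -> y <=o s).
  by exists d => y _; left.
have sd : s <=o d by apply: slub => y _; left.
suff Es : E s by exists s; split=> //; split=> //; case: sd Es => // ->.
apply: NNPP => NEs; apply: (NEs); apply: (clubP cE).
  by exists y0; case: (sE _ Ey0 y0d) => // Eys; case: NEs; rewrite -Eys.
move=> b bs; apply: NNPP => N; suff sb : s <=o b by oo.
apply: slub => y Ey yd; apply: oleNgt => by_; apply: N; exists y; split=> //; split=> //.
by case: (sE _ Ey yd) => // Eys; case: NEs; rewrite -Eys.
Qed.

Lemma delta_sym (x y : node K) d : olt d x.1 -> olt d y.1 ->
  delta_is olt x y d -> delta_is olt y x d.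
Proof.
move=> dx dy [[_ [_ [H1 H2]]]|[H [_ [_ [Ed|Ed]]]]]; last 2 first.
- by rewrite Ed in dx; case: (oirr dx).
- by rewrite Ed in dy; case: (oirr dy).
left; do ![split=> //]; last by move=> e; apply: H2.
by move=> xi ?; rewrite H1.
Qed.

Lemma in_level (x : node K) b : in_T olt C x -> b <=o x.1 -> level b (cut b x.2).
Proof.
move=> [d [xd Hx]] bx; exists d; apply: eq_cut => xi xib.
by apply: rho0_rho; apply: (Hx xi).1; oo.
Qed.

Lemma eq_map_In (A B : Type) (f f' : A -> B) l a :
  map f l = map f' l -> List.In a l -> f a = f' a.
Proof. by elim: l => //= b l IH [e /IH {}IH] [<-|]. Qed.

Lemma cat_injr (A : Type) (s t t' : seq A) : s ++ t = s ++ t' -> t = t'.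
Proof. by move=> /cat_inj []. Qed.

(* The nodes split where [rho] at the two points they pass through does, whatever
   their prefixes. *)
Lemma common_split n (S : ('I_n -> node K) -> Prop) fam : (0 < n)%N ->
  (forall x, S x -> forall k, in_T olt C (x k)) -> rapid olt S -> unbounded_family S fam ->
  exists w, forall s, List.In s fam -> exists x y d, S x /\ S y /\ x <> y /\
    (forall k, (x k).1 <o (y k).1) /\ last_E d <o d /\
    forall k, delta_is olt (x k) (y k) d /\ (x k).2 (last_E d) = s k ++ w.
Proof.
move=> n0 ST rS [e ue]; have [eta [e_eta Eeta]] := club_unbounded cE e.
pose G y := eta <o y /\ E y /\ List.Forall (acc_at S e y) fam.
have uG : unbounded G.
  move=> b; have [c [bc [ec _]]] := omax b eta; have [y [cy [Ey Hy]]] := ue c.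
  by exists y; split; [|split=> //]; oo.
have [k0] := o_inh.
have [|X HX] := @choose_fun_in (K * ('I_n -> seq K)) ('I_n -> node K) (fun _ => (k0, fun _ => [::]))
    (fun p => G p.1 /\ List.In p.2 fam)
    (fun p x => S x /\ forall k, pass (x k) e p.1 (p.2 k)).
  by move=> [y s] /= [[_ [_ /List.Forall_forall H]] /H [x [? ?]]]; exists x.
(* The code records [rho] and the chosen nodes below [eta], a small amount of data. With equal
   codes, differences occur only from [eta] on, where the prefixes are in force. *)
pose code y := (cut eta (fun xi => rho xi y), [seq (fun k => cut eta (X (y, s) k).2) | s <- fam]).
have [|y|y [y' [yy' [Gy [Gy' [Ec Ef0]]]]]] := @pigeonhole _
  (fun p => level eta p.1 /\ List.Forall (fun f : 'I_n -> _ => forall k, level eta (f k)) p.2)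
  code G _ uG.
- exact: small_prod (small_level eta) (small_seq (small_tuple (n := n) (small_level eta))).
- move=> Gy; split; first by exists y.
  rewrite /code /=; apply: Forall_map; apply/List.Forall_forall => s sf k.
  have [SX HXk] := HX (y, s) (conj Gy sf); apply: in_level; first exact: ST.
  by have [/= yx _] := HXk k; have [? _] := Gy; oo.
have Ef := fun s => eq_map_In (a := s) Ef0.
have [etay [Ey _]] := Gy; have [etay' _] := Gy'.
have [d [dy [nd [Ed Nd]]]] := rho_split (EV Ey) yy'.
have NEd : ~ E d by move=> /EV.
have etad : eta <o d.
  apply: oltNge => -[deta|deta]; last by case: NEd; rewrite deta.
  by apply: nd; move: (congr1 (fun f => f d) Ec); rewrite !cut_in.
have [Ee [ed emax]] := last_EP NEd (ex_intro _ eta (conj Eeta etad)).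
have etae := emax _ Eeta etad.
exists (rho (last_E d) y) => s sf.
have [Sx Hx] := HX (y, s) (conj Gy sf); have [Sx' Hx'] := HX (y', s) (conj Gy' sf).
set x := X (y, s) in Sx Hx; set x' := X (y', s) in Sx' Hx'; rewrite /= in Hx Hx'.
have dx k : d <o (x k).1 by have [? _] := Hx k; oo.
have dx' k : d <o (x' k).1 by have [? _] := Hx' k; oo.
have delta k : delta_is olt (x k) (x' k) d.
  have [_ Pk] := Hx k; have [_ Pk'] := Hx' k; left; do ![split=> //].
    move=> xi xid; case: (classic (xi <o eta)) => [xe|/oleNgt ex].
      have := congr1 (fun f => f k xi) (Ef _ sf); rewrite /= !cut_in //.
    rewrite Pk; [|by oo|by oo]; rewrite Pk' ?Ed //; by oo.
  rewrite Pk; [|by oo|by oo]; rewrite Pk'; [|by oo|by oo].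
  by move=> /cat_injr.
have val k : (x k).2 (last_E d) = s k ++ rho (last_E d) y.
  by have [_ Pk] := Hx k; apply: Pk; oo.
have xx' : x <> x'.
  move=> exx; have := delta (Ordinal n0); rewrite exx => -[[_ [_ [_ []]]] //|[_ [_ [_ Hd]]]].
  by have := dx' (Ordinal n0); case: Hd => <- /oirr.
(* If the heights come in the other order, the tuples are exchanged; they have the same values at
   [last_E d]. *)
case: (rS _ _ Sx Sx' xx') => lt.
  by exists x, x', d; do ![split=> //].
exists x', x, d; do ![split=> //]; first by move=> e'; apply: xx'.
- exact: delta_sym.
- rewrite -val; case: (delta k) => [[_ [_ [H _]]]|[H _]]; first by rewrite H.
  by have ? := dx k; have ? := dx' k; rewrite H //; oo.
Qed.

(** * Building threads *)

Hypothesis HT : forall nu, positive nu (fun _ => True).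

Section Threads.
Variables (n : nat) (S : ('I_n -> node K) -> Prop).
Implicit Types (s : 'I_n -> seq K) (fam : seq ('I_n -> seq K)).

Definition top_lt s s' := forall k k', (top (map h (s k)) < top (map h (s' k')))%N.

(** New threads enter at the head with record letters. The resulting distinct maxima let a table
    tell the threads apart. *)
Definition decreasing fam := forall s0 i j, (i < j < size fam)%N -> top_lt (nth s0 fam j) (nth s0 fam i).

Lemma decreasing_neq fam s0 i j k k' : decreasing fam -> (i < size fam)%N -> (j < size fam)%N ->
  i <> j -> top (map h (nth s0 fam i k)) <> top (map h (nth s0 fam j k')).
Proof.
move=> dec si sj ij eq; case: (ltngtP i j) => // H.
  by have := dec s0 i j; rewrite H sj => /(_ isT k' k); rewrite eq ltnn.
by have := dec s0 j i; rewrite H si => /(_ isT k k'); rewrite eq ltnn.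
Qed.

Lemma fin_bound (T : finType) (f : T -> nat) : exists b, forall x, (f x <= b)%N.
Proof. by exists (\max_x f x) => x; apply: leq_bigmax. Qed.

Lemma top_bound fam s0 : exists b, forall i k, (i < size fam)%N -> (top (map h (nth s0 fam i k)) <= b)%N.
Proof.
have [b Hb] := fin_bound (fun x : 'I_(size fam) * 'I_n => top (map h (nth s0 fam x.1 x.2))).
by exists b => i k si; apply: (Hb (Ordinal si, k)).
Qed.

(** Every thread extends the first one, which preserves [Q]; each new label [b.+1] exceeds all
    earlier maxima. *)
Lemma grow_threads nu e s (Q : ('I_n -> seq K) -> Prop) N : positive nu (fun d => acc_at S e d s) ->
  Q s -> (forall s t, Q s -> Q (ext s t)) ->
  exists e fam, size fam = N.+1 /\ decreasing fam /\ List.Forall Q fam /\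
    positive nu (fun d => List.Forall (acc_at S e d) fam).
Proof.
move=> pos Qs Qext; elim: N => [|N [e0 [fam [sz [dec [Qf posf]]]]]].
  exists e, [:: s]; split=> //; split; first by move=> s0 i [|j] //; rewrite andbF.
  split; first by constructor.
  by move=> D /pos [d [Hd ?]]; exists d; split=> //; constructor.
case: fam sz dec Qf posf => // s0 fam [sz] dec Qf posf.
have [b Hb] := top_bound (s0 :: fam) s0.
have [o [t [e' [_ [ho pos']]]]] := add_thread b.+1 posf.
exists e', (ext s0 (o :: t) :: s0 :: fam); split; first by rewrite /= sz.
split; last by split=> //; constructor=> //; apply: Qext; have /List.Forall_cons_iff [] := Qf.
move=> s1 [|i] [|j] // jsz; last exact: (dec s1 i j).
move=> k k'; rewrite /ext map_cat; apply: leq_trans (top_cons_cat _ _ _).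
by rewrite ho /= (set_nth_default s0) // ltnS; apply: Hb.
Qed.

Variables (iota : 'I_n -> 'I_n) (cols : 'I_n -> M).
Variable f0 : state n.

(** Vacuous for constant [iota], the case of a single colour; for [iota] the identity it separates
    all components. *)
Definition apart s := forall k k', iota k <> iota k' ->
  separated f0 (map h (s k)) (map h (s k')).

Definition coloured (cl : 'I_n -> nat) (c : 'I_n) s :=
  forall k, exists o, g o = cols c /\ first_of_class n h (s k) (cl c) = Some o.

Lemma apart_ext s t : apart s -> apart (ext s t).
Proof. by move=> H k k' /H; rewrite /ext !map_cat; apply: separated_cat. Qed.

Lemma coloured_ext cl c s t : coloured cl c s -> coloured cl c (ext s t).
Proof. by move=> H k; have [o [? Ho]] := H k; exists o; split=> //; apply: first_of_class_cat. Qed.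

(** Colours are secured one at a time: a jump appends a letter of colour [cols c] and of a class [i]
    absent from the current word. Later letters do not change the first letter of a class. *)
Lemma assign_classes (l : seq 'I_n) : accessible S apart ->
  accessible S (fun s => apart s /\ exists cl, forall c, c \in l -> coloured cl c s).
Proof.
move=> acc; elim: l => [|c l IH].
  by apply: accessible_sub acc => s; split=> //; exists (fun=> 0).
have [e [s [[ap [cl Hcl]] pos]]] := accessible_press (HT (cols c)) IH.
have [b Hb] := choose_fun (fun k => fresh_class n h (s k)).
have [i Hi] := fin_bound b.
have [m [_ [clm _]]] := @move_ex n [::] (fun=> ([::], 1%g)) i 0.
have [o [go [ho uo]]] : exists o, g o = cols c /\ h o = m /\ unbounded_family S [:: ext s [:: o]].
  apply: (@jump _ _ (cols c) e [:: s]) => D /pos [d [[_ ?] ?]]; exists d; split=> //.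
  by constructor.
apply: accessible_sub (unbounded_accessible uo) => _ [t ->].
split; first by do 2!apply: apart_ext.
exists (fun a => if a == c then i else cl a) => a; rewrite inE; case: eqP => [-> _|ne /= al].
  move=> k; rewrite eqxx; exists o; split=> //; rewrite /ext -catA Hb //.
  by rewrite /first_of_class /= ho clm eqxx.
move=> k; rewrite (introF eqP ne); do 2!apply: coloured_ext; exact: Hcl.
Qed.

(** Classes, threads and the common record letter [m] are fixed before the suffix [w] is known; only
    then is the thread [q] picked. *)
Lemma key : (0 < n)%N -> forall c0,
  (forall x, S x -> forall k, in_T olt C (x k)) -> rapid olt S -> accessible S apart ->
  exists x y, S x /\ S y /\ x <> y /\
    good_pair olt 1 (fun t : node K => colour f0 g h c0 (t.2 (last_E t.1))) x y
      (fun k => cols (iota k)).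
Proof.
move=> n0 c0 ST rS acc.
have [e [s [[ap [cl Hcl]] pos]]] := accessible_press (HT c0) (assign_classes (enum 'I_n) acc).
pose Q s := apart s /\ forall c, coloured cl c s.
have [J HJ] := fin_bound cl.
pose Pi := {ffun 'I_J.+1 -> {perm state n}}.
(* The number of threads suffices for one per family of permutations of the coordinates up to
   [J]. *)
have [||e1 [fam [sz [dec [/List.Forall_forall Qf posf]]]]] :=
    @grow_threads c0 e s Q #|Pi| (fun D cD => let: ex_intro d (conj (conj _ H1) H2) := pos D cD in
      ex_intro _ d (conj H1 H2)).
- by split=> // c; apply: Hcl; rewrite mem_enum.
- by move=> s' t [? Hs']; split=> [|c]; [apply: apart_ext|apply: coloured_ext].
pose v (q : Pi) := nth s fam (enum_rank q).
have vsz (q : Pi) : (enum_rank q < size fam)%N by rewrite sz ltnS ltnW.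
have vin q : List.In (v q) fam by apply: In_nth.
have [b Hb] := top_bound fam s.
have [||||m [_ Hm]] := @covering n f0 (fun k => cl (iota k)) J (fun q k => map h (v q k)) b.
- by move=> k; apply: HJ.
- by move=> q k k' ne; apply: (Qf _ (vin q)).1 => eq; rewrite eq in ne.
- move=> q q' k k' ne; apply: decreasing_neq => //.
  by move/ord_inj/enum_rank_inj.
- by move=> q k; apply: Hb.
have [o [_ [ho uo]]] := jump m posf.
have [w Hw] := common_split n0 ST rS uo; have [q Hq] := Hm (map h w).
have [|x [y [d [Sx [Sy [xy [lt [ed Hd]]]]]]]] := Hw (ext (v q) [:: o]).
  exact: In_map (vin q).
exists x, y; do ![split=> //]; exists (fun=> d), [:: d]; split=> // k.
have [del val] := Hd k; split=> //; split; first by left.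
split; last by move=> _; apply: lt.
rewrite [_.2 _](@cut_in _ d (x k).2) // val /ext -catA.
have [o' [<- fo]] := (Qf _ (vin q)).2 (iota k) k.
have [H1 H2] := Hq k.
apply: (@colourE _ _ _ _ _ _ _ _ (cl (iota k))); rewrite ?map_cat /= ?ho //.
exact: first_of_class_cat.
Qed.

End Threads.

(** * The partition relation for the tree *)

Lemma not_small_inj (A : Type) (P : A -> Prop) (f : K -> A) :
  injective f -> (forall a, P (f a)) -> ~ small P.
Proof.
move=> fi fP sP; have /(_ id) [b Hb] : small (fun _ : K => True).
  by apply: (small_inj (j := f)) sP => // a a' _ _ /fi.
by have /oirr := Hb b I.
Qed.

Lemma large_accessible n (S : ('I_n -> node K) -> Prop) :
  (forall x, S x -> forall k, in_T olt C (x k)) ->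
  (forall b, exists x, S x /\ forall k, b <=o (x k).1) -> accessible S (fun _ => True).
Proof.
move=> ST large; have [k0] := o_inh; exists k0 => d Ad _; have [x [Sx Hx]] := large d.
have [|w Hw] := @choose_fun 'I_n (K * seq K) (fun k es => es.1 <o d /\
    List.Forall (fun z => z <o d) es.2 /\ pass (x k) es.1 d es.2).
  move=> k; have [b [xb Hb]] := ST x Sx k; have dx := Hx k.
  have db : d <=o b by oo.
  have [e [s [ed [sd Es]]]] := walk_split_A Ad db; exists (e, s); split=> //; split=> //.
  split=> // xi exi xid; rewrite -Es //; last by left.
  by apply: rho0_rho; apply: (Hb xi).1; oo.
have [|||c [cd Hc]] := @fin_max _ (fun k b => (w k).1 <=o b /\ List.Forall (fun z => z <=o b) (w k).2) d.
- exact: (acc_kappaP Ad.1).1.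
- by move=> k b c bc [? ?]; split; [oo|apply: Forall_le_mono bc _].
- move=> k; have [ed [sd _]] := Hw k; have [b [bd Hb]] := Forall_max (acc_kappaP Ad.1).1 sd.
  have [c [ec [bc cd]]] := omax_lt ed bd; exists c; split=> //; split=> //.
  exact: Forall_le_mono Hb.
exists c, c, (fun k => (w k).2); split; first exact: ole_refl.
split=> //; split; first by move=> k; case: (Hc k).
split=> //; exists x; split=> // k; have [_ [_ p]] := Hw k; exact: pass_le (Hc k).1 p.
Qed.

(** Distinct tuples of a rapid family share no height, so picking a component below [b] in each
    would inject [κ] into [b]. *)
Lemma rapid_large n (S : ('I_n -> node K) -> Prop) : rapid olt S -> has_size_kappa K S ->
  forall b, exists x, S x /\ forall k, b <=o (x k).1.
Proof.
move=> rS [f [fS [fi _]]] b; apply: NNPP => N.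
have [|k Hk] := @choose_fun K 'I_n (fun a k => (f a k).1 <o b).
  move=> a; apply: NNPP => N'; apply: N; exists (f a); split=> // k.
  by apply: oleNgt => lt; apply: N'; exists k.
apply: (not_small_inj (f := fun a => (f a (k a)).1) _ Hk (small_below b)) => a a' eq.
apply: fi; apply: NNPP => ne.
by case: (rS _ _ (fS a) (fS a') ne) => /(_ (k a) (k a')); rewrite eq => /oirr.
Qed.

(** Both clauses reduce to [key], with [iota] constant and the identity respectively. For the
    second, [n] threads through [T'], viewed as a family of one-tuples, form the components of
    [n]-tuples and are separated by one letter. *)
Lemma tree_arrow n : (0 < n)%N -> neg_arrow olt C n 1 M.
Proof.
move=> n0; have [k0] := o_inh; pose f0 : state n := (false, Ordinal n0).
pose c0 := g k0.
exists (fun t : node K => colour f0 g h c0 (t.2 (last_E t.1))); split.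
  move=> S ST rS sS nu.
  apply: (@key n S (fun=> Ordinal n0) (fun=> nu) f0 n0 c0 ST rS).
  by apply: accessible_sub (large_accessible ST (rapid_large rS sS)) => s _ k k'.
move=> T' T'T [f [fT [fi _]]].
pose S1 (x : 'I_1 -> node K) := T' (x ord0).
have acc1 : accessible S1 (fun _ => True).
  apply: large_accessible => [x Tx k|b]; first by rewrite (ord1 k); apply: T'T.
  (* Otherwise all heights in [T'] lie below [b], and [T'] is contained in a small union of small
     levels. *)
  apply: NNPP => N; apply: (not_small_inj fi fT).
  apply: (small_sub (Q := fun x => exists d, d <o b /\ (in_T olt C x /\ x.1 = d))) => [x Tx|].
    exists x.1; split; last by split=> //; apply: T'T.
    by apply: oltNge => bx; apply: N; exists (fun=> x); split.
  apply: small_bigU (small_below b) _ => d _.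
  apply: (small_image (f := pair d)) (small_level d) => x [Tx xd].
  exists x.2; split; last by rewrite -xd; case: (x).
  have -> : x.2 = cut d x.2; last by apply: in_level => //; right.
  apply: functional_extensionality => xi; rewrite /cut; case: excluded_middle_informative => // nx.
  by have [e [_ He]] := Tx; apply: (He xi).2; rewrite xd.
have [e0 [s0 [_ pos0]]] := accessible_press (HT c0) acc1.
have [|//|//|e1 [fam [sz [dec [_ posf]]]]] := @grow_threads 1 S1 c0 e0 s0 (fun _ => True) n.
  by move=> D /pos0 [d [[_ ?] ?]]; exists d.
pose s1 k := nth s0 fam k ord0.
have szk (k : 'I_n) : (k < size fam)%N by rewrite sz ltnS ltnW.
have [b Hb] := top_bound fam s0.
have [||m [_ Hm]] := @separating n f0 (fun k => map h (s1 k)) b.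
- move=> k k' ne; apply: decreasing_neq => // /ord_inj //.
- by move=> k; apply: Hb.
have [o [_ [ho [e ue]]]] := jump m posf.
pose s (k : 'I_n) := s1 k ++ [:: o].
pose G y := E y /\ List.Forall (acc_at S1 e y) [seq ext s [:: o] | s <- fam].
have [|z Hz] := @choose_fun_in K ('I_n -> node K) (fun=> (k0, fun=> [::])) G
    (fun y z => forall k, T' (z k) /\ pass (z k) e y (s k)).
  move=> y [_ /List.Forall_forall Hy].
  have [|x Hx] := @choose_fun 'I_n ('I_1 -> node K)
    (fun k x => S1 x /\ forall j, pass (x j) e y (ext (nth s0 fam k) [:: o] j)).
    by move=> k; apply: Hy; apply: In_map; apply: In_nth.
  by exists (fun k => x k ord0) => k; have [? ?] := Hx k; split.
have [B HB] := choose_fun (fun y => Forall_max_any [seq (z y k).1 | k <- enum 'I_n]).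
have zB y k : (z y k).1 <=o B y.
  move/List.Forall_forall: (HB y); apply; apply: (@In_map _ _ (fun k => (z y k).1)).
  have := mem_enum 'I_n k; rewrite inE; elim: (enum _) => //= a l IH.
  by rewrite inE => /orP [/eqP ->|/IH]; [left|right].
(* For [eta] in [D] and [p] below it, all heights in [z p] lie below [eta]. Keeping in [G'] only the
   least point of [G] from each [eta] on thus makes the tuples rapid. *)
have [|||D [cD HD]] := @club_diagonal K (fun b p => p <=o b) (fun p y => B p <o y).
- exact: small_le.
- by move=> b1 b2 p ? ?; oo.
- by move=> p; apply: club_above.
pose G' y := G y /\ exists eta, D eta /\ eta <=o y /\ forall y', G y' -> eta <=o y' -> y <=o y'.
have G'lt y y' k k' : G' y -> G' y' -> y <o y' -> (z y k).1 <o (z y' k').1.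
  move=> [Gy _] [Gy' [eta [Deta [ey' ymin]]]] yy'.
  have ye : y <o eta by apply: oltNge => /(ymin _ Gy) ?; oo.
  have ? := (HD _ Deta).2 y y ye (ole_refl y); have ? := zB y k.
  have [_ [? _]] := Hz _ Gy' k'; oo.
have G'neq y y' : G' y -> G' y' -> z y = z y' -> y = y'.
  move=> Gy Gy' eq; case: (ototal y y') => [lt|[//|lt]].
    by have := G'lt _ _ (Ordinal n0) (Ordinal n0) Gy Gy' lt; rewrite eq => /oirr.
  by have := G'lt _ _ (Ordinal n0) (Ordinal n0) Gy' Gy lt; rewrite eq => /oirr.
have [p [pi pG]] : exists p : K -> K, injective p /\ forall x, G' (p x).
  case: HK => _ [_ [_ [_ [_ [reg _]]]]]; apply: reg => b1.
  have [eta [beta Deta]] := club_unbounded cD b1; have [y1 [ey1 Gy1]] := ue eta.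
  have [|y [[Gy ey] ymin]] := @oleast (fun y => G y /\ eta <=o y).
    by exists y1; split=> //; left.
  exists y; split; last by oo.
  by split=> //; exists eta; do ![split=> //] => y' Gy' ey'; apply: ymin.
exists (fun x => exists a, x = z (p a)); split; first by move=> _ [a ->] k; case: (Hz _ (pG a).1 k).
split.
  move=> _ _ [a ->] [a' ->] ne; case: (ototal (p a) (p a')) => [lt|[eq|lt]].
  - by left=> k k'; apply: G'lt.
  - by rewrite eq in ne.
  - by right=> k k'; apply: G'lt.
split.
  exists (fun a => z (p a)); split; first by move=> a; exists a.
  split=> [a a' eq|_ [a ->]]; last by exists a.
  by apply: pi; apply: G'neq eq.
move=> S SS' sS tau.
apply: (@key n S id tau f0 n0 c0).
- by move=> x /SS' [a ->] k; apply: T'T; case: (Hz _ (pG a).1 k).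
- move=> x x' /SS' [a ->] /SS' [a' ->] ne; case: (ototal (p a) (p a')) => [lt|[eq|lt]].
  + by left=> k k'; apply: G'lt.
  + by rewrite eq in ne.
  + by right=> k k'; apply: G'lt.
(* A family of size [κ] cannot live on a bounded set of points, so [S] inherits the words [s]. *)
have us : unbounded_family S [:: s].
  exists e => b1; have [F [FS [Fi _]]] := sS.
  have [q Hq] := choose_fun (fun a => SS' _ (FS a)).
  apply: NNPP => N; apply: (not_small_inj (f := fun a => p (q a)) (P := fun y => y <=o b1)).
  - by move=> a a' eq; apply: Fi; rewrite !Hq eq.
  - move=> a; apply: oleNgt => lt; apply: N; exists (p (q a)); split=> //.
    have Gq := (pG (q a)).1; split; first by case: Gq.
    constructor=> //; exists (F a); split=> // k; rewrite Hq.
    by case: (Hz _ Gq k).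
  - exact: small_le.
apply: accessible_sub (unbounded_accessible us) => _ [t ->]; apply: apart_ext => k k' ne.
by rewrite /s !map_cat /= ho; apply: Hm.
Qed.

End Walks.

Theorem theorem9p2 (K : Type) (olt : K -> K -> Prop) (M : Type) (C : K -> K -> Prop) :
  kreg_uncountable olt ->
  C_sequence olt C ->
  weakly_coherent olt C ->
  (exists D, club olt D /\ forall d, D d -> V_set olt C d) ->
  in_Theta1 olt M nat C (A_set olt C) (R_set olt C) ->
  forall n : nat, (0 < n)%N -> neg_arrow olt C n 1 M.
Proof.
move=> HK HC Hwc [E [cE EV]] [g [h HT]] n n0.
apply: (tree_arrow HK HC Hwc cE EV (g := g) (h := h)) n0 => nu D cD.
by have [d [Ad gd]] := HT D cD nu; exists d.
Qed.
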